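(* Let $p$ be a prime and $e$ a positive integer with $e\mid p-1$ and $e\le (p-1)/2$. Given two oracles $\mathcal{O}_{e,s}$ and $\mathcal{O}_{e,t}$ for some unknown $s,t\in\mathbb{F}_p$, there is a deterministic algorithm which decides whether $s=t$ in time $p^{1/2+o(1)}$ as $p\to\infty$.
   Context: For a prime $p$, a positive integer $e\mid p-1$ and a hidden element $s\in\mathbb{F}_p$, the oracle $\mathcal{O}_{e,s}$ is a black box which, on any input $x\in\mathbb{F}_p$, returns $(x+s)^e\in\mathbb{F}_p$. Running time counts bit operations, each oracle call having unit cost. *)

(* Defs.v *)
From mathcomp Require Import all_boot.
Unset Printing Implicit Defensive.

Inductive Mv := MvL | MvR | MvS.
Definition Sym := option bool.   (* None = blank *)

Record tape := Tape { tcont : nat -> Sym; thead : nat }.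

Definition tread (t : tape) : Sym := tcont t (thead t).
Definition twrite_move (t : tape) (a : Sym) (m : Mv) : tape :=
  Tape (fun i => if i == thead t then a else tcont t i)
       (match m with MvL => (thead t).-1 | MvR => (thead t).+1 | MvS => thead t end).

Fixpoint bits_to_nat (l : seq bool) : nat :=
  if l is b :: l' then b + 2 * bits_to_nat l' else 0.
Fixpoint nat_to_bits_aux (fuel n : nat) : seq bool :=
  if fuel is f.+1 then (if n == 0 then [::] else odd n :: nat_to_bits_aux f n./2)
  else [::].
Definition nat_to_bits (n : nat) : seq bool := nat_to_bits_aux n n.

Definition tape_of_syms (l : seq Sym) : tape := Tape (fun i => nth None l i) 0.
Definition blank_tape : tape := Tape (fun _ => None) 0.
Definition input_tape (p e : nat) : tape :=
  tape_of_syms (map Some (nat_to_bits p) ++ None :: map Some (nat_to_bits e)).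
Definition query (t : tape) : nat :=
  bits_to_nat [seq (tcont t i == Some true) | i <- iota 0 (thead t)].

(* Tape 0 = input tape, tape 1 = query tape, tape 2 = answer tape,
   plus ntapes further work tapes. *)
Record OTM := {
  ntapes : nat;
  st : finType;
  q_start : st; q_acc : st; q_rej : st;
  q_ask1 : st; q_ask2 : st; q_ret : st;
  delta : st -> ('I_ntapes.+3 -> Sym) -> st * ('I_ntapes.+3 -> Sym * Mv)
}.

Definition config (M : OTM) := (st M * ('I_(ntapes M).+3 -> tape))%type.

(* One step; a call to an oracle (state q_ask1 / q_ask2) costs one step:
   the answer f(query) is written in binary on the answer tape. *)
Definition step (M : OTM) (f1 f2 : nat -> nat) (c : config M) : config M :=
  let: (q, tp) := c in
  if (q == q_acc M) || (q == q_rej M) then c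
  else if q == q_ask1 M then
    (q_ret M, fun i => if i == inord 2 then
       tape_of_syms (map Some (nat_to_bits (f1 (query (tp (inord 1)))))) else tp i)
  else if q == q_ask2 M then
    (q_ret M, fun i => if i == inord 2 then
       tape_of_syms (map Some (nat_to_bits (f2 (query (tp (inord 1)))))) else tp i)
  else
    let: (q', act) := delta M q (fun i => tread (tp i)) in
    (q', fun i => twrite_move (tp i) (act i).1 (act i).2).

Definition init (M : OTM) (p e : nat) : config M :=
  (q_start M, fun i => if i == ord0 then input_tape p e else blank_tape).

Definition run (M : OTM) (f1 f2 : nat -> nat) (T : nat) (c : config M) : config M :=
  iter T (step M f1 f2) c.

Definition outputs_within (M : OTM) (p e : nat) (f1 f2 : nat -> nat)
    (T : nat) (b : bool) : bool :=
  let q := (run M f1 f2 T (init M p e)).1 in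
  if b then q == q_acc M else (q == q_rej M) && (q != q_acc M).

(* the oracle O_{e,s} over F_p, elements of F_p represented by 0..p-1;
   inputs are read modulo p *)
Definition oracle (p e s : nat) : nat -> nat := fun x => (x + s) ^ e %% p.

Definition valid_input (p e s t : nat) : Prop :=
  [/\ prime p, 0 < e, e %| p.-1, e <= p.-1 %/ 2 & (s < p) && (t < p)].

(* Main.v *)
(* Suppose (x+s)^e = (x+t)^e for all x < 2^B, where s <> t. For the k pairs
   (a_i, b_i) = (-s-i, -t-i) every x in a slightly shorter interval satisfies
   (x-a_i)^e = (x-b_i)^e for all i, so the 2^k products of e-th powers obtained by
   choosing a_i or b_i for each i take the same value at x. Stepanov's method then
   applies: some combination of these products with polynomial coefficients of small
   degree vanishes at all these x to order about 2^k, while its degree is O(ke).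
   Taking 4^k close to e/k gives 2^B = O(sqrt(e) k^(3/2)), so p^(1/2 + o(1)) values
   of x suffice.

   What has to be shown is that the combination is not zero. This is a zero estimate:
   a nonzero combination cannot vanish to order E at a point outside the roots a_i, b_i,
   for a suitable E <= min(e, p-e). By a Wronskian argument it is enough that the
   products are independent over the polynomials in X^p; a relation over these can be
   reduced modulo (X-a_k)^p to one with constant coefficients, and in the latter the
   terms containing (X-a_k)^e are separated from the others by their order at a_k, so
   that the zero estimate for k-1 pairs applies to both groups.

   The Turing machine compares the two oracles at all x < 2^B, with the width
   B = (log p)/2 + O(sqrt(log p)) marked in unary on a tape of its own. *)
From HB Require Import structures.
From mathcomp Require Import all_boot all_fingroup all_algebra.
From mathcomp Require Import zify ring.
From Stdlib Require Import FunctionalExtensionality.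
Require Import Defs.
Set Implicit Arguments.
Unset Strict Implicit.
Unset Printing Implicit Defensive.
Import GRing.Theory.

(** * Wronskians of polynomials in characteristic [p] *)

Section Wronskian.
Local Open Scope ring_scope.
Variable F : fieldType.

(** The factor [Q], later the product of all linear factors in play, clears the denominators of
    logarithmic derivatives. *)
Definition qderiv (Q v : {poly F}) : {poly F} := Q * v^`().

Lemma qderiv_sum Q (I : Type) (r : seq I) (P : pred I) (G : I -> {poly F}) :
  qderiv Q (\sum_(i <- r | P i) G i) = \sum_(i <- r | P i) qderiv Q (G i).
Proof. by rewrite /qderiv raddf_sum mulr_sumr. Qed.

Lemma qderivM Q v w : qderiv Q (v * w) = qderiv Q v * w + v * qderiv Q w.
Proof. by rewrite /qderiv derivM; ring. Qed.

Lemma qderiv_iter_sum Q j (I : Type) (r : seq I) (P : pred I) (G : I -> {poly F}) :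
  iter j (qderiv Q) (\sum_(i <- r | P i) G i) =
  \sum_(i <- r | P i) iter j (qderiv Q) (G i).
Proof. by elim: j => [//|j IHj] /=; rewrite IHj qderiv_sum. Qed.

Lemma derivXp p (u : {poly F}) : p \in [pchar F] -> (u ^+ p)^`() = 0.
Proof.
move=> charF; rewrite deriv_exp -mulr_natr.
suff -> : (p%:R : {poly F}) = 0 by rewrite mulr0.
by rewrite -polyC_natr (pcharf0 charF).
Qed.

(** By induction the leading minor may be taken nonzero. Differentiating the relations of a kernel
    vector [w] then shows that the quotients [w i / w n] have zero derivative. *)
Lemma wronskian_dep p (Q : {poly F}) (n : nat) (u : nat -> {poly F}) :
  p \in [pchar F] ->
  Q != 0 ->
  \det (\matrix_(i < n, j < n) iter j (qderiv Q) (u i)) = 0 ->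
  exists c : nat -> {poly F}, [/\ forall i, (c i)^`() = 0,
    exists2 i, (i < n)%N & c i != 0 & \sum_(i < n) c i * u i = 0].
Proof.
move=> charF Q0; elim: n => [|n IHn]; first by rewrite det_mx00 => /eqP; rewrite oner_eq0.
set A := \matrix_(_ , _) _.
move=> detA.
set A' := \matrix_(i < n, j < n) iter j (qderiv Q) (u i) in IHn.
case: (eqVneq (\det A') 0) => [/IHn[c [cc [i lin ci] sc]]|detA'].
  exists (fun i => if (i < n)%N then c i else 0); split.
  - by move=> j; case: ifP => // _; rewrite derivC.
  - by exists i; [exact: ltnW | rewrite lin].
  - rewrite big_ord_recr /= ltnn mul0r addr0; apply: etrans sc.
    by apply: eq_bigr => j _; rewrite ltn_ord.
have /det0P[w0 w0n w0A] : \det A == 0 by rewrite detA.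
pose w i : {poly F} := w0 0 (inord i).
have wA j : (j < n.+1)%N -> \sum_(i < n.+1) w i * iter j (qderiv Q) (u i) = 0.
  move=> jn; move/matrixP/(_ 0 (Ordinal jn)): w0A; rewrite !mxE => w0A; apply: etrans w0A.
  by apply: eq_bigr => i _; rewrite mxE /w inord_val.
have full (v : nat -> {poly F}) :
    (forall j, (j < n)%N -> \sum_(i < n) v i * iter j (qderiv Q) (u i) = 0) ->
    forall i, (i < n)%N -> v i = 0.
  move=> vA i lin; apply/eqP/negPn/negP => vi.
  case/negP: detA'; apply/det0P; exists (\row_(i < n) v i).
    apply: contraNneq vi => /matrixP/(_ 0 (Ordinal lin)).
    by rewrite !mxE => ->.
  apply/matrixP => a j; rewrite !mxE; apply: etrans (vA j (ltn_ord j)).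
  by apply: eq_bigr => k _; rewrite !mxE.
have wn0 : w n != 0.
  apply: contra w0n => /eqP wn0; apply/eqP/rowP => i; rewrite mxE.
  have -> : w0 0 i = w i by rewrite /w inord_val.
  have := ltn_ord i; rewrite ltnS leq_eqVlt => /orP[/eqP-> //|]; apply: full => j jn.
  by have := wA j (ltnW jn); rewrite big_ord_recr /= wn0 mul0r addr0.
(* The numerators of the derivatives of [w i / w n] form a vector in the left kernel of the
   nonsingular minor. *)
have wz i : (i < n.+1)%N -> w n * (w i)^`() - (w n)^`() * w i = 0.
  rewrite ltnS leq_eqVlt => /orP[/eqP->|]; first by ring.
  apply: (full (fun i => w n * (w i)^`() - (w n)^`() * w i)) => j jn.
  have E1 := wA j (ltnW jn).
  have := congr1 (qderiv Q) E1; rewrite qderiv_sum.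
  under eq_bigr => k _ do rewrite qderivM -iterS /qderiv.
  rewrite big_split /= (wA j.+1) // addr0 [RHS]/qderiv derivC mulr0.
  move=> E2.
  have E3 : \sum_(i0 < n.+1) Q * ((w n * (w i0)^`() - (w n)^`() * w i0)
       * iter j (qderiv Q) (u i0)) = 0.
    rewrite (eq_bigr (fun k : 'I_n.+1 => w n * (Q * (w k)^`() * iter j (qderiv Q) (u k))
       - Q * (w n)^`() * (w k * iter j (qderiv Q) (u k)))); last first.
      by move=> k _; ring.
    by rewrite sumrB -!mulr_sumr E1 E2 !mulr0 subr0.
  move: E3; rewrite -mulr_sumr => /eqP; rewrite mulf_eq0 (negPf Q0) /= big_ord_recr /=.
  rewrite [X in _ + X](_ : _ = 0); last by ring.
  by rewrite addr0 => /eqP.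
(* This is [w i / w n] times [w n ^+ p]: the denominator is cleared by a factor of zero
   derivative. *)
exists (fun i => if (i < n.+1)%N then w i * w n ^+ p.-1 else 0); split.
- move=> i; case: ifP => [/wz E|_]; last by rewrite derivC.
  have := prime_gt1 (pcharf_prime charF); case Ep: p => [//|[//|q]] _ /=.
  rewrite derivM deriv_exp /= exprS -mulr_natr.
  have -> : (q.+1)%:R = -1 :> {poly F}.
    apply/eqP; rewrite -subr_eq0 opprK natr1 -Ep -polyC_natr (pcharf0 charF).
    by rewrite polyC0.
  transitivity ((w n * (w i)^`() - (w n)^`() * w i) * w n ^+ q); first by ring.
  by rewrite E mul0r.
- by exists n => //; rewrite ltnSn mulf_neq0 // expf_neq0.
- have /= E := wA 0%N isT; apply: etrans (mulr0 (w n ^+ p.-1)); apply: etrans (congr1 _ E).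
  rewrite mulr_sumr.
  by apply: eq_bigr => i _; rewrite ltn_ord; ring.
Qed.

Lemma size_det_leq (n d : nat) (A : 'M[{poly F}]_n) :
  (forall i j, (size (A i j) <= d.+1)%N) -> (size (\det A) <= (n * d).+1)%N.
Proof.
move=> sA; apply: (leq_trans (size_sum _ _ _)); apply/bigmax_leqP => s _.
rewrite mulr_sign; apply: (@leq_trans (size (\prod_i A i (s i)))).
  by case: (_ s) => //; rewrite size_polyN.
apply: (leq_trans (size_poly_prod_leq _ _)).
have : (\sum_(i < n) size (A i (s i)) <= \sum_(i < n) d.+1)%N by apply: leq_sum.
rewrite !sum_nat_const !cardT !size_enum_ord; move: (\sum_(i < n) _)%N => x.
by nia.
Qed.

Lemma dvdp_qderiv Q (a : F) E (V : {poly F}) :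
  ('X - a%:P) ^+ E %| V -> ('X - a%:P) ^+ E.-1 %| qderiv Q V.
Proof.
case: E => [|E] /=; first by rewrite expr0 !dvd1p.
case/dvdpP => u ->; rewrite /qderiv derivM deriv_exp derivXsubC mul1r /=.
apply: dvdp_mull; apply: dvdp_add; first by rewrite exprS mulrA dvdp_mull.
rewrite -mulr_natr (_ : _ * _ = u * E.+1%:R * ('X - a%:P) ^+ E); last by ring.
by rewrite dvdp_mulIr.
Qed.

Lemma dvdp_qderiv_iter Q (a : F) E j (V : {poly F}) :
  ('X - a%:P) ^+ E %| V -> ('X - a%:P) ^+ (E - j) %| iter j (qderiv Q) V.
Proof.
move=> dV; elim: j => [|j IHj] /=; first by rewrite subn0.
by rewrite subnS; apply: dvdp_qderiv.
Qed.

(** The operator that [qderiv Q] induces on the cofactor [v] of [v * h] when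
    [qderiv Q h = q * h]. *)
Definition twist (Q q v : {poly F}) := qderiv Q v + q * v.

Lemma size_twist d (Q q v : {poly F}) : (size Q <= d.+1)%N -> (size q <= d.+1)%N ->
  (size (twist Q q v) <= size v + d)%N.
Proof.
move=> sQ sq; apply: (leq_trans (size_polyD _ _)); rewrite geq_max.
have [->|v0] := eqVneq v 0.
  by rewrite /qderiv derivC !mulr0 size_poly0.
have sv : (0 < size v)%N by rewrite size_poly_gt0.
apply/andP; split; apply: (leq_trans (size_polyMleq _ _)).
  by have := lt_size_deriv v0; lia.
by lia.
Qed.

Lemma size_twist_iter d (Q q v : {poly F}) j : (size Q <= d.+1)%N -> (size q <= d.+1)%N ->
  (size (iter j (twist Q q) v) <= size v + d * j)%N.
Proof.
move=> sQ sq; elim: j => [|j IHj] /=; first by rewrite muln0 addn0.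
apply: (leq_trans (size_twist _ sQ sq)).
by rewrite mulnS addnCA addnC leq_add2l.
Qed.

Lemma qderiv_iter_twist (Q q h v : {poly F}) j : qderiv Q h = q * h ->
  iter j (qderiv Q) (v * h) = iter j (twist Q q) v * h.
Proof.
move=> Dh; elim: j => [//|j IHj] /=.
by rewrite IHj qderivM Dh /twist; ring.
Qed.

(** The Wronskian is the product of the [h i] times [\det B], where [B] has entries of small degree.
    By Cramer's rule [\det B * h 0] is a combination of the first [n] iterated derivatives of the
    sum, so [(X - a)^(E - n)] divides it; as [h 0] does not vanish at [a], it divides [\det B],
    whose degree is too small unless [\det B = 0]. *)
Lemma wronskian_multiplicity (n d R E : nat) (Q : {poly F}) (h q r : nat -> {poly F})
    (a : F) :
  (size Q <= d.+1)%N -> (forall i, size (q i) <= d.+1)%N ->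
  (forall i, size (r i) <= R)%N ->
  (forall i, qderiv Q (h i) = q i * h i) -> (forall i, ~~ root (h i) a) ->
  (0 < n)%N -> ('X - a%:P) ^+ E %| \sum_(i < n) r i * h i ->
  (n * (R + d * n) + n < E)%N ->
  \det (\matrix_(i < n, j < n) iter j (qderiv Q) (r i * h i)) = 0.
Proof.
move=> sQ sq sr Dh ha n0 dV ltE.
set A := \matrix_(_, _) _.
pose B : 'M[{poly F}]_n := \matrix_(i < n, j < n) iter j (twist Q (q i)) (r i).
have AB : A = diag_mx (\row_(i < n) h i) *m B.
  apply/matrixP => i j; rewrite mul_diag_mx !mxE.
  by rewrite (qderiv_iter_twist _ _ (Dh i)) mulrC.
suff B0 : \det B = 0 by rewrite AB det_mulmx B0 mulr0.
pose V (j : 'I_n) := iter j (qderiv Q) (\sum_(i < n) r i * h i).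
have VB : \row_j V j = (\row_(i < n) h i) *m B.
  apply/rowP => j; rewrite !mxE /V qderiv_iter_sum; apply: eq_bigr => i _.
  by rewrite !mxE (qderiv_iter_twist _ _ (Dh i)) mulrC.
have Cr : (\row_j V j) *m \adj B = \det B *: (\row_(i < n) h i).
  by rewrite VB -mulmxA mul_mx_adj mul_mx_scalar.
move/rowP/(_ (Ordinal n0)): Cr; rewrite !mxE /= => Cr.
have dD : ('X - a%:P) ^+ (E - n) %| \det B * h 0%N.
  rewrite -Cr; apply: (big_ind (fun x => ('X - a%:P) ^+ (E - n) %| x)) => [||j _];
    [exact: dvdp0 | exact: dvdp_add |].
  rewrite mxE; apply: dvdp_mulr; apply: dvdp_trans (dvdp_qderiv_iter Q j dV).
  by apply: dvdp_exp2l; have := ltn_ord j; lia.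
have co : coprimep (('X - a%:P) ^+ (E - n)) (h 0%N).
  by rewrite coprimep_sym coprimep_expr // coprimep_XsubC.
move: dD; rewrite Gauss_dvdpl // => dD.
apply/eqP/negPn/negP => B0; have := dvdp_leq B0 dD.
rewrite size_exp_XsubC => sB.
have : (size (\det B) <= (n * (R + d * n)).+1)%N.
  apply: size_det_leq => i j; rewrite mxE.
  apply: (leq_trans (size_twist_iter _ _ sQ (sq i))).
  by have := ltn_ord j; have := sr i; nia.
by move=> sD; have := leq_trans sB sD; lia.
Qed.

End Wronskian.

(** * Products of [e]-th powers and their combinations *)

Section PowerProducts.
Local Open Scope ring_scope.
Variables (F : fieldType) (e : nat).

(* [pprod l m] is the product over the pairs (a, b) of [l] of (X - a)^e or
   (X - b)^e, the choice being dictated by the binary digits of [m]. *)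
Fixpoint pprod (l : seq (F * F)) (m : nat) : {poly F} :=
  if l is (a, b) :: l' then ('X - (if odd m then a else b)%:P) ^+ e * pprod l' m./2
  else 1.

Fixpoint linprod (l : seq (F * F)) : {poly F} :=
  if l is (a, b) :: l' then ('X - a%:P) * ('X - b%:P) * linprod l' else 1.

(** The logarithmic derivative of [pprod l m] multiplied by [linprod l], hence a polynomial, of
    degree independent of [e]. *)
Fixpoint logder (l : seq (F * F)) (m : nat) : {poly F} :=
  if l is (a, b) :: l' then
    e%:R * (('X - (if odd m then b else a)%:P) * linprod l')
    + ('X - a%:P) * ('X - b%:P) * logder l' m./2
  else 0.

Definition proots (l : seq (F * F)) : seq F := unzip1 l ++ unzip2 l.

(** Asymmetric on purpose: orders of vanishing are examined only at first entries, so only these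
    must avoid the later pairs, while second entries may recur. *)
Fixpoint separated (l : seq (F * F)) : bool :=
  if l is (a, b) :: l' then [&& a != b, a \notin proots l' & separated l'] else true.

Definition comb (l : seq (F * F)) (r : nat -> {poly F}) : {poly F} :=
  \sum_(m < 2 ^ size l) r m * pprod l m.

Lemma in_proots_cons x a b l :
  (x \in proots ((a, b) :: l)) = [|| x == a, x == b | x \in proots l].
Proof. by rewrite /proots /= !inE !mem_cat !inE; do ![case: (_ \in _) | case: (_ == _)]. Qed.

Lemma pprod_logder l m : qderiv (linprod l) (pprod l m) = logder l m * pprod l m.
Proof.
elim: l m => [|[a b] l IHl] m /=; first by rewrite /qderiv derivC mulr0 mul0r.
have {}IHl := IHl m./2; rewrite /qderiv in IHl *.
rewrite derivM deriv_exp derivXsubC mul1r -mulr_natl.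
have E (c : F) : e%:R * ('X - c%:P) ^+ e.-1 * ('X - c%:P) = e%:R * ('X - c%:P) ^+ e.
  by case: e => [|e'] /=; [rewrite !mul0r | rewrite exprS; ring].
set h := pprod _ _ in IHl *; set h' := h^`() in IHl *; set Q := linprod l in IHl *.
set q := logder _ _ in IHl *.
set c := (if odd m then a else b); set c' := (if odd m then b else a).
have -> : ('X - a%:P) * ('X - b%:P) = ('X - c%:P) * ('X - c'%:P) :> {poly F}.
  by rewrite /c /c'; case: (odd m) => //; rewrite mulrC.
transitivity ((e%:R * ('X - c%:P) ^+ e.-1 * ('X - c%:P)) * ('X - c'%:P) * Q * h
  + ('X - c%:P) * ('X - c'%:P) * ('X - c%:P) ^+ e * (Q * h')); first by ring.
by rewrite IHl E; ring.
Qed.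

Lemma size_mulXsubC (c : F) (q : {poly F}) : q != 0 ->
  size (('X - c%:P) * q) = (size q).+1.
Proof. by move=> q0; rewrite size_mul ?polyXsubC_eq0 // size_XsubC. Qed.

Lemma size_linprod l : size (linprod l) = (2 * size l).+1.
Proof.
elim: l => [|[a b] l IHl] /=; first by rewrite size_poly1.
have l0 : linprod l != 0 by rewrite -size_poly_gt0 IHl.
rewrite -mulrA size_mulXsubC ?mulf_neq0 ?polyXsubC_eq0 //.
by rewrite size_mulXsubC // IHl; lia.
Qed.

Lemma linprod_neq0 l : linprod l != 0.
Proof. by rewrite -size_poly_gt0 size_linprod. Qed.

Lemma root_linprod l x : root (linprod l) x = (x \in proots l).
Proof.
elim: l => [|[a b] l IHl] /=; first by rewrite (negPf (root1 _)).
by rewrite in_proots_cons !rootM !root_XsubC IHl orbA.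
Qed.

Lemma size_logder l m : (size (logder l m) <= (2 * size l).+1)%N.
Proof.
elim: l m => [|[a b] l IHl] m; first by rewrite /= size_poly0.
set s := size l.
have -> : size ((a, b) :: l) = s.+1 by [].
rewrite [logder _ _]/=; apply: (leq_trans (size_polyD _ _)); rewrite geq_max.
apply/andP; split.
  rewrite -polyC_natr mul_polyC; apply: (leq_trans (size_scale_leq _ _)).
  by rewrite size_mulXsubC ?linprod_neq0 // size_linprod -/s; lia.
have [->|q0] := eqVneq (logder l m./2) 0; first by rewrite mulr0 size_poly0.
rewrite -mulrA size_mulXsubC ?mulf_neq0 ?polyXsubC_eq0 // size_mulXsubC //.
by have := IHl m./2; rewrite -/s; move: (size _) => z; lia.
Qed.

Lemma size_pprod l m : size (pprod l m) = (size l * e).+1.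
Proof.
elim: l m => [|[a b] l IHl] m /=; first by rewrite size_poly1.
rewrite size_mul ?expf_neq0 ?polyXsubC_eq0 //; last by rewrite -size_poly_gt0 IHl.
by rewrite size_exp_XsubC IHl; lia.
Qed.

Lemma root_pprod l m x : x \notin proots l -> ~~ root (pprod l m) x.
Proof.
elim: l m => [|[a b] l IHl] m /=; first by rewrite root1.
rewrite in_proots_cons !negb_or => /and3P[xa xb xl].
rewrite rootM negb_or IHl // andbT rootE hornerE expf_neq0 // hornerXsubC subr_eq0.
by case: ifP.
Qed.

Lemma sum_odd_even (V : nmodType) n (G : nat -> V) :
  \sum_(m < 2 * n) G m = \sum_(m < n) G m.*2.+1 + \sum_(m < n) G m.*2.
Proof.
elim: n => [|n IHn]; first by rewrite !big_ord0 addr0.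
rewrite (_ : 2 * n.+1 = (2 * n).+2)%N; last by lia.
rewrite !big_ord_recr /= IHn -!addrA; congr (_ + _).
by rewrite !mul2n addrA addrC.
Qed.

(** The lowest binary digit of an index selects the factor of the first pair: odd indices carry [a],
    even ones [b]. *)
Lemma comb_cons a b l r :
  comb ((a, b) :: l) r = ('X - a%:P) ^+ e * comb l (fun m => r m.*2.+1)
                       + ('X - b%:P) ^+ e * comb l (fun m => r m.*2).
Proof.
rewrite /comb [size _]/= expnS (sum_odd_even _ (fun m => r m * pprod ((a, b) :: l) m)).
congr (_ + _); rewrite mulr_sumr; apply: eq_bigr => m _ /=.
  by rewrite odd_double /= uphalf_double mulrCA.
by rewrite odd_double /= doubleK mulrCA.
Qed.

Lemma combM l (g : {poly F}) r : comb l (fun m => g * r m) = g * comb l r.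
Proof. by rewrite /comb mulr_sumr; apply: eq_bigr => m _; rewrite mulrA. Qed.

Lemma combD l r1 r2 : comb l (fun m => r1 m + r2 m) = comb l r1 + comb l r2.
Proof. by rewrite /comb -big_split; apply: eq_bigr => m _ /=; rewrite mulrDl. Qed.

Lemma eq_comb l r1 r2 : (forall m, (m < 2 ^ size l)%N -> r1 m = r2 m) ->
  comb l r1 = comb l r2.
Proof. by move=> E; apply: eq_bigr => m _; rewrite E. Qed.

(** If [c - c(a)] is nonzero, its order at [a] is a multiple of [p], since otherwise differentiation
    would lower it by exactly one instead of giving zero. Thus [(X - a)^p] divides it, and the
    quotient again has zero derivative. *)
Lemma const_decomp p (a : F) (c : {poly F}) : p \in [pchar F] -> c^`() = 0 ->
  exists2 c1 : {poly F}, c1^`() = 0 & c = (c.[a])%:P + ('X - a%:P) ^+ p * c1.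
Proof.
move=> charF c'.
have [c0|c0] := eqVneq (c - (c.[a])%:P) 0.
  by exists 0; rewrite ?derivC // mulr0 addr0; apply/eqP; rewrite -subr_eq0 c0.
have [[|j] [u ru Eu]] := multiplicity_XsubC (c - (c.[a])%:P) a.
  move: Eu; rewrite expr0 mulr1 c0 /= in ru * => Eu.
  by case/negP: ru; rewrite -Eu rootE !hornerE subrr.
rewrite c0 /= in ru.
have D0 : (u * ('X - a%:P) ^+ j.+1)^`() = 0 by rewrite -Eu derivB c' derivC subr0.
have pj : (p %| j.+1)%N.
  rewrite (dvdn_pcharf charF).
  move: D0; rewrite derivM deriv_exp derivXsubC mul1r /= -mulr_natr.
  rewrite (_ : _ + _ = (u^`() * ('X - a%:P) + u * j.+1%:R) * ('X - a%:P) ^+ j); last first.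
    by rewrite exprS; ring.
  move/eqP; rewrite mulf_eq0 (negPf (expf_neq0 _ _)) ?polyXsubC_eq0 // orbF.
  move/eqP/(congr1 (fun q : {poly F} => q.[a])).
  rewrite !hornerE subrr mulr0 add0r => /eqP.
  by rewrite mulf_eq0 -rootE (negPf ru) /= -polyC_natr hornerC.
have [k Ek] : exists k, j.+1 = (p + k)%N.
  by exists (j.+1 - p)%N; rewrite subnKC // dvdn_leq.
exists (u * ('X - a%:P) ^+ k); last by rewrite mulrCA -exprD -Ek -Eu addrC subrK.
apply/eqP; move/eqP: D0.
rewrite Ek exprD mulrCA derivM (derivXp _ charF) mul0r add0r mulf_eq0.
by rewrite (negPf (expf_neq0 _ _)) ?polyXsubC_eq0.
Qed.

End PowerProducts.

(** * The zero estimate for combinations of power products *)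

Section ZeroEstimate.
Local Open Scope ring_scope.
Variables (F : fieldType) (p : nat).
Hypothesis charF : p \in [pchar F].
Variable e : nat.
Hypothesis e_le_p : (e <= p)%N.

Let p_prime : prime p := pcharf_prime charF.

(** The hypothesis on [rho] is the zero estimate for [l] at [a]. It is applicable because reducing
    [c m] modulo [(X - a)^p] leaves a scalar, so the size bound [R] of [r m] is kept. *)
Lemma comb_const_indep (a b : F) l (r c : nat -> {poly F}) R E :
  a != b -> a \notin proots l -> (E <= e)%N -> (E <= p - e)%N ->
  (forall rho : nat -> {poly F}, (forall m, (size (rho m) <= R)%N) ->
     ('X - a%:P) ^+ E %| comb e l rho ->
     forall m, (m < 2 ^ size l)%N -> rho m = 0) ->
  (forall m, (size (r m) <= R)%N) -> (forall m, (c m)^`() = 0) ->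
  comb e ((a, b) :: l) (fun m => c m * r m) = 0 ->
  forall m, (m < 2 ^ (size l).+1)%N -> c m * r m = 0.
Proof.
move=> ab al Ee Epe Z sr.
set N2 := (2 ^ (size l).+1)%N; set A : {poly F} := 'X - a%:P in Z *.
have A0 n : A ^+ n != 0 by rewrite expf_neq0 // polyXsubC_eq0.
(* Descent on a bound for the sizes of the [c m]: once the scalar parts are shown to contribute
   nothing, a factor [A ^+ p] cancels and smaller coefficients [c1 m] remain. *)
suff H n : (forall m, (m < N2)%N -> (size (c m) <= n)%N) -> (forall m, (c m)^`() = 0) ->
  comb e ((a, b) :: l) (fun m => c m * r m) = 0 ->
  forall m, (m < N2)%N -> c m * r m = 0.
  apply: (H (\max_(m < N2) size (c m))) => m lm.
  by rewrite (leq_bigmax_cond (Ordinal lm)).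
elim: n c => [|n IHn] c sc cc c0 m lm.
  by have := sc _ lm; rewrite size_poly_leq0 => /eqP->; rewrite mul0r.
pose c1 m := (c m - ((c m).[a])%:P) %/ A ^+ p.
have [c1c c1E] : (forall m, (c1 m)^`() = 0) /\
    (forall m, c m = ((c m).[a])%:P + A ^+ p * c1 m).
  suff K m' : (c1 m')^`() = 0 /\ c m' = ((c m').[a])%:P + A ^+ p * c1 m'.
    by split=> m'; case: (K m').
  have [d d' dE] := const_decomp a charF (cc m').
  suff -> : c1 m' = d by [].
  by rewrite /c1 {1}dE addrC addKr mulKp ?A0.
pose rho m := ((c m).[a])%:P * r m.
have srho m' : (size (rho m') <= R)%N.
  by rewrite /rho mul_polyC; apply: leq_trans (size_scale_leq _ _) (sr _).
have Erho : comb e ((a, b) :: l) rho = - (A ^+ p * comb e ((a, b) :: l) (fun m => c1 m * r m)).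
  apply/eqP; rewrite -addr_eq0 -combM -combD -c0; apply/eqP; apply: eq_comb => k _.
  by rewrite [in RHS](c1E k) /rho; ring.
have dvd_p : A ^+ p %| comb e ((a, b) :: l) rho by rewrite Erho dvdpNr dvdp_mulIl.
rewrite comb_cons -/A in dvd_p.
(* The odd terms are divisible by [A ^+ e], hence so are the even ones, whose factor [(X - b)^e] is
   prime to [A]. *)
have rho_even k : (k < 2 ^ size l)%N -> rho k.*2 = 0.
  apply: (Z (fun k => rho k.*2)) => //; apply: (@dvdp_trans _ (A ^+ e)); first exact: dvdp_exp2l.
  rewrite -(@Gauss_dvdpr _ _ (('X - b%:P) ^+ e)); last first.
    rewrite coprimep_expl // coprimep_expr // coprimep_XsubC root_XsubC eq_sym.
    by rewrite eq_sym eq_sym.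
  rewrite -(@dvdp_addr _ (A ^+ e * comb e l (fun m => rho m.*2.+1))) ?dvdp_mulIl //.
  by apply: dvdp_trans dvd_p; apply: dvdp_exp2l.
(* With the even terms gone, cancelling [A ^+ e] from a multiple of [A ^+ p] leaves order [p - e],
   which is at least [E]. *)
have rho_odd k : (k < 2 ^ size l)%N -> rho k.*2.+1 = 0.
  apply: (Z (fun k => rho k.*2.+1)) => //; apply: (@dvdp_trans _ (A ^+ (p - e))).
    exact: dvdp_exp2l.
  rewrite -(@dvdp_mul2l _ (A ^+ e)) ?A0 // -exprD subnKC //.
  move: dvd_p; rewrite (_ : comb e l (fun m => rho m.*2) = 0) ?mulr0 ?addr0 //.
  by rewrite /comb big1 // => i _; rewrite rho_even // mul0r.
have rho0 k : (k < N2)%N -> rho k = 0.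
  rewrite /N2 expnS => lk; rewrite -(odd_double_half k).
  have lk2 : (k./2 < 2 ^ size l)%N by move: lk; move: (2 ^ _)%N => z; lia.
  by case: (odd k); rewrite ?add1n ?add0n ?rho_odd ?rho_even.
have cE k : (k < N2)%N -> c k * r k = A ^+ p * (c1 k * r k).
  by move=> lk; rewrite {1}c1E mulrDl -/(rho k) rho0 // add0r mulrA.
rewrite cE // IHn ?mulr0 //.
  move=> k lk; have := sc _ lk.
  have [->|c10] := eqVneq (c1 k) 0; first by rewrite size_poly0.
  have Es : size (c k - ((c k).[a])%:P) = (p + size (c1 k))%N.
    by rewrite {1}(c1E k) addrC addKr size_mul ?A0 // /A size_exp_XsubC addSn.
  move=> sck; have h : (p + size (c1 k) <= maxn (size (c k)) 1)%N.
    rewrite -Es; apply: leq_trans (size_polyD _ _) _.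
    by rewrite size_polyN geq_max leq_maxl /= leq_max size_polyC_leq1 orbT.
  have : (1 + size (c1 k) <= n.+1)%N; last by [].
  apply: leq_trans (leq_add (prime_gt0 p_prime) (leqnn _)) (leq_trans h _).
  by rewrite geq_max sck.
apply/eqP; have : A ^+ p * comb e ((a, b) :: l) (fun m => c1 m * r m) = 0.
  by rewrite -combM -[RHS]c0; apply: eq_comb => k lk; rewrite cE.
by move/eqP; rewrite mulf_eq0 (negPf (A0 p)).
Qed.

(** The order at [a] makes the Wronskian of the terms vanish, which yields a relation over
    coefficients of zero derivative. This relation is refuted by the estimate for one pair less,
    taken at the first entry of the removed pair; the point therefore has to be arbitrary in the
    induction. *)
Lemma zero_estimate l R E a (r : nat -> {poly F}) :
  separated l -> a \notin proots l -> (forall m, (size (r m) <= R)%N) ->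
  (2 ^ size l * (R + 2 * size l * 2 ^ size l) + 2 ^ size l < E)%N ->
  (E <= e)%N -> (E <= p - e)%N ->
  ('X - a%:P) ^+ E %| comb e l r ->
  forall m, (m < 2 ^ size l)%N -> r m = 0.
Proof.
elim: l a r => [|[a0 b0] l IHl] a r.
  move=> _ _ sr; rewrite /= expn0 /comb => ltE _ _.
  rewrite /= expn0 big_ord1 mulr1 => dr [|//] _; apply/eqP/negPn/negP => r0.
  by have := leq_trans (dvdp_leq r0 dr) (sr 0%N); rewrite size_exp_XsubC; lia.
move=> sep al sr ltE Ee Epe dr m0 lm0.
apply/eqP/negPn/negP => rm0.
have /and3P[ab0 al0 sepl] := sep.
set l' := (a0, b0) :: l in sep al ltE dr lm0 *.
set N := (2 ^ size l')%N in lm0 ltE.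
(* Terms with zero coefficient are dropped, since a dependence supported on them would be no
   contradiction. *)
pose s := [seq m <- iota 0 N | r m != 0].
have us : uniq s by rewrite filter_uniq // iota_uniq.
have ms : m0 \in s by rewrite mem_filter rm0 mem_iota.
have n0 : (0 < size s)%N by case: (s) ms.
have sN : (size s <= N)%N.
  by rewrite -[X in (_ <= X)%N](size_iota 0) size_filter count_size.
have sumE (G : nat -> {poly F}) : (forall m, r m = 0 -> G m = 0) ->
    \sum_(i < size s) G (nth 0%N s i) = \sum_(m < N) G m.
  move=> G0; rewrite -(big_mkord xpredT G) -(big_mkord xpredT (fun i => G (nth 0%N s i))).
  rewrite -(big_nth 0%N xpredT G) /s big_filter /index_iota subn0 [LHS]big_mkcond.
  by apply: eq_bigr => m _; case: eqVneq => //= /G0.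
have dW : ('X - a%:P) ^+ E %| \sum_(i < size s) r (nth 0%N s i) * pprod e l' (nth 0%N s i).
  by rewrite (sumE (fun m => r m * pprod e l' m)) // => m ->; rewrite mul0r.
have W0 : \det (\matrix_(i < size s, j < size s)
    iter j (qderiv (linprod l')) (r (nth 0%N s i) * pprod e l' (nth 0%N s i))) = 0.
  apply: (@wronskian_multiplicity F (size s) (2 * size l') R E (linprod l')
    (fun i => pprod e l' (nth 0%N s i)) (fun i => logder e l' (nth 0%N s i))
    (fun i => r (nth 0%N s i)) a) => //.
  - by rewrite size_linprod.
  - by move=> i; apply: size_logder.
  - by move=> i; apply: pprod_logder.
  - by move=> i; apply: root_pprod.
  - apply: leq_ltn_trans ltE; apply: leq_add => //; apply: leq_mul => //.
    by rewrite leq_add2l; apply: leq_mul.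
have [c [cc [i li ci] c0]] := wronskian_dep
  (u := fun i => r (nth 0%N s i) * pprod e l' (nth 0%N s i)) charF (linprod_neq0 l') W0.
pose c' m := if r m == 0 then 0 else c (index m s).
have lN : (2 ^ size l <= N)%N by rewrite leq_exp2l.
have sm : nth 0%N s i \in s by rewrite mem_nth.
suff : c' (nth 0%N s i) * r (nth 0%N s i) = 0.
  move: sm; rewrite mem_filter /c' => /andP[rs _]; rewrite (negPf rs) index_uniq // => /eqP.
  by rewrite mulf_eq0 (negPf ci) (negPf rs).
apply: (@comb_const_indep a0 b0 l r c' R E) => //.
- move=> rho srho; apply: IHl => //; apply: leq_ltn_trans ltE.
  apply: leq_add => //; apply: leq_mul => //.
  by rewrite leq_add2l; apply: leq_mul => //; rewrite leq_mul2l /= leqnSn.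
- by move=> m; rewrite /c'; case: ifP => // _; rewrite derivC.
- apply: etrans c0; rewrite /comb -(sumE (fun m => c' m * r m * pprod e l' m)).
    apply: eq_bigr => j _; rewrite /c'.
    have : nth 0%N s j \in s by rewrite mem_nth.
    rewrite mem_filter => /andP[/negPf-> _].
    by rewrite index_uniq // mulrA.
  by move=> m ->; rewrite mulr0 mul0r.
- by move: sm; rewrite mem_filter mem_iota => /andP[_].
Qed.

End ZeroEstimate.

(** * Orders of vanishing from iterated derivatives *)

Section Vanishing.
Local Open Scope ring_scope.
Variables (F : fieldType) (p : nat).
Hypothesis charF : p \in [pchar F].

(** A zero of order [j] with [0 < j < p] becomes a zero of order exactly [j - 1] under the
    derivation, because [j] is invertible in [F] and [Q] does not vanish at [y]. *)
Lemma dvdp_XsubC_lift (Q V : {poly F}) (y : F) M : ~~ root Q y -> root V y -> (M < p)%N ->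
  ('X - y%:P) ^+ M %| qderiv Q V -> ('X - y%:P) ^+ M.+1 %| V.
Proof.
move=> Qy Vy ltMp dM; have [->|V0] := eqVneq V 0; first exact: dvdp0.
have [j [u ru EV]] := multiplicity_XsubC V y; rewrite V0 /= in ru.
case: (leqP M.+1 j) => [Mj|]; first by rewrite EV dvdp_mull // dvdp_exp2l.
case: j EV => [|j] EV; first by move: ru; rewrite expr0 mulr1 in EV; rewrite -EV Vy.
rewrite ltnS => jM.
have : ('X - y%:P) ^+ j.+1 %| qderiv Q V by apply: dvdp_trans dM; apply: dvdp_exp2l.
rewrite EV /qderiv derivM deriv_exp derivXsubC mul1r /= -mulr_natr.
rewrite (_ : Q * _ = ('X - y%:P) ^+ j * (Q * (u^`() * ('X - y%:P) + u * j.+1%:R))); last first.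
  by rewrite exprS; ring.
rewrite exprSr dvdp_mul2l ?expf_neq0 ?polyXsubC_eq0 // dvdp_XsubCl rootM (negPf Qy) /=.
rewrite rootE !hornerE subrr mulr0 add0r mulf_eq0 -rootE (negPf ru) /=.
rewrite -polyC_natr hornerC -(dvdn_pcharf charF) => /dvdn_leq-/(_ isT).
by rewrite leqNgt (leq_ltn_trans jM ltMp).
Qed.

Lemma dvdp_XsubC_iter (Q V : {poly F}) (y : F) M : ~~ root Q y -> (M <= p)%N ->
  (forall j, (j < M)%N -> root (iter j (qderiv Q) V) y) -> ('X - y%:P) ^+ M %| V.
Proof.
move=> Qy; elim: M V => [|M IHM] V lM H; first by rewrite expr0 dvd1p.
have lM1 := ltnW lM; apply: dvdp_XsubC_lift Qy _ lM _; first exact: (H 0%N).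
by apply: IHM; [exact: lM1 | move=> j jM; rewrite -iterSr; exact: H].
Qed.

Lemma twist_iterB (Q q v w : {poly F}) j :
  iter j (twist Q q) (v - w) = iter j (twist Q q) v - iter j (twist Q q) w.
Proof. by elim: j => [//|j IHj] /=; rewrite IHj /twist /qderiv derivB; ring. Qed.

Lemma dvdp_prod_XsubC_exp (Y : seq F) M (V : {poly F}) : uniq Y ->
  (forall y, y \in Y -> ('X - y%:P) ^+ M %| V) -> \prod_(y <- Y) ('X - y%:P) ^+ M %| V.
Proof.
elim: Y => [|y Y IHY] /=; first by rewrite big_nil dvd1p.
move=> /andP[yY uY] H; rewrite big_cons Gauss_dvdp; last first.
  rewrite coprimep_expl // prodrXl coprimep_expr // coprimep_sym coprimep_XsubC.
  by rewrite root_prod_XsubC.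
by rewrite H ?mem_head // IHY // => z zY; apply: H; rewrite inE zY orbT.
Qed.

End Vanishing.

(** * Stepanov's auxiliary polynomial *)

Section Stepanov.
Local Open Scope ring_scope.

(** Pigeonhole: there are more choices of the [N] coefficients than values of the [M] sums, so [r]
    is the difference of two choices with equal sums. The sums vanish as polynomials, which serves
    all points of agreement at once. *)
Lemma auxiliary_coefficients (F : finFieldType) (d N M R : nat) (Q : {poly F})
    (q : nat -> {poly F}) :
  (size Q <= d.+1)%N -> (forall m, (size (q m) <= d.+1)%N) ->
  (M * (R + d * M) < N * R)%N ->
  exists r : nat -> {poly F}, [/\ forall m, (size (r m) <= R)%N,
    exists2 m, (m < N)%N & r m != 0 &
    forall j, (j < M)%N -> \sum_(m < N) iter j (twist Q (q m)) (r m) = 0].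
Proof.
move=> sQ sq lt_dim; pose C := (R + d * M)%N.
pose G (x : {ffun 'I_N -> 'rV[F]_R}) (j : nat) : {poly F} :=
  \sum_(m < N) iter j (twist Q (q m)) (rVpoly (x m)).
have sG x j : (j < M)%N -> (size (G x j) <= C)%N.
  move=> jM; apply: (leq_trans (size_sum _ _ _)); apply/bigmax_leqP => m _.
  apply: (leq_trans (size_twist_iter _ _ sQ (sq m))).
  by apply: leq_add; [exact: size_poly | rewrite leq_mul2l (ltnW jM) orbT].
pose T (x : {ffun 'I_N -> 'rV[F]_R}) : {ffun 'I_M -> 'rV[F]_C} :=
  [ffun j => poly_rV (G x (j : 'I_M))].
have /injectivePn[x [y xy Txy]] : ~~ injectiveb T.
  apply/injectiveP => /leq_card; rewrite !card_ffun !card_mx !card_ord !mul1n -!expnM.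
  rewrite leq_exp2l ?card_finNzRing_gt1 // => h.
  by move: lt_dim h; rewrite -/C; clear; nia.
pose r m : {poly F} := if insub m is Some i then rVpoly (x i - y i) else 0.
have rE (m : 'I_N) : r m = rVpoly (x m) - rVpoly (y m).
  by rewrite /r insubT //= => lm; rewrite -raddfB; congr (rVpoly (x _ - y _)); apply: val_inj.
exists r; split.
- by move=> m; rewrite /r; case: insubP => [i _ _|_]; rewrite ?size_poly ?size_poly0.
- have /existsP[m xym] : [exists m, x m != y m].
    apply: contraR xy => /existsPn H; apply/eqP/ffunP => m; apply/eqP.
    by have := H m; rewrite negbK.
  exists m => //; rewrite rE subr_eq0; apply: contra xym => /eqP E.
  by rewrite -(rVpolyK (x m)) E rVpolyK.
move=> j jM; under eq_bigr => m _ do rewrite rE twist_iterB.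
rewrite sumrB -!/(G _ j); apply/eqP; rewrite subr_eq0; apply/eqP.
move/ffunP/(_ (Ordinal jM)): Txy; rewrite !ffunE /= => E.
by rewrite -(poly_rV_K (sG x j jM)) E poly_rV_K // sG.
Qed.

(** With [M = 2 ^ k], the nonzero [V] is divisible by [(X - y)^M] for every [y] in [Y], and
    comparing degrees bounds [size Y]. *)
Lemma stepanov_bound (F : finFieldType) (p e k : nat) (l : seq (F * F)) (Y : seq F) :
  p \in [pchar F] -> size l = k.+1 -> separated l ->
  (6 * k.+1 * 4 ^ k.+1 <= e)%N -> (e <= p - e)%N ->
  uniq Y -> (forall y, y \in Y -> y \notin proots l) ->
  (forall y a b, y \in Y -> (a, b) \in l -> (y - a) ^+ e = (y - b) ^+ e) ->
  (size Y * 2 ^ k <= 2 * k.+1 * e)%N.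
Proof.
move=> charF sl sep le_e e_p uY Yl Ye.
case EY: Y => [//|y0 Y']; rewrite -EY.
have y0Y : y0 \in Y by rewrite EY mem_head.
set M := (2 ^ k)%N; set N := (2 ^ k.+1)%N.
have NM : N = (2 * M)%N by rewrite /N expnS.
have M0 : (0 < M)%N by rewrite expn_gt0.
have N4 : (4 ^ k.+1 = N * N)%N by rewrite -expnMn.
(* The least [R] with [M * (R + 2 * k.+1 * M) < N * R], given [N = 2 * M]. *)
pose R := (k.+1 * N).+1.
have sQ : (size (linprod l) <= (2 * k.+1).+1)%N by rewrite size_linprod sl.
have sq m : (size (logder e l m) <= (2 * k.+1).+1)%N by rewrite -sl; apply: size_logder.
have lt_dim : (M * (R + 2 * k.+1 * M) < N * R)%N.
  by rewrite /R NM; move: (M) M0 => x x0; clear -x0; nia.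
have [r [sr [m0 lm0 rm0] r0]] := auxiliary_coefficients sQ sq lt_dim.
pose V := comb e l r.
have eN : (6 * k.+1 * (N * N) <= e)%N by rewrite -N4.
(* A zero [V] would vanish at [y0] to order [e], so the zero estimate with [E = e] would kill every
   coefficient; the factor 6 in the hypothesis on [e] leaves room for it. *)
have V0 : V != 0.
  apply: contra rm0 => /eqP V0; apply/eqP.
  apply: (@zero_estimate F p charF e _ l R e y0 r) => //; rewrite ?sl //.
  - by clear -e_p; lia.
  - exact: Yl.
  - rewrite -/N; apply: leq_trans eN; rewrite /R.
    by move: (N) (M) NM M0 => n m nm m_gt0; clear -nm m_gt0; nia.
  - by rewrite -/V V0 dvdp0.
have hy y : y \in Y -> forall m, (pprod e l m).[y] = (pprod e l 0).[y].
  move=> yY; move: (fun a b => Ye y a b yY); clear; elim: l => [//|[a b] l IHl] H m /=.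
  rewrite !hornerM !horner_exp !hornerXsubC IHl; last first.
    by move=> a1 b1 l1; apply: H; rewrite inE l1 orbT.
  by congr (_ * _); case: ifP => // _; apply: H; rewrite mem_head.
have dV y : y \in Y -> ('X - y%:P) ^+ M %| V.
  move=> yY; apply: (@dvdp_XsubC_iter F p charF (linprod l)).
  - by rewrite root_linprod Yl.
  - have Mk : (M <= N * N)%N by rewrite NM; move: (M) M0 => m m_gt0; clear -m_gt0; nia.
    by move: (N * N)%N (M) eN e_p Mk; clear; nia.
  (* The products share one value at [y]; it factors out of the [j]-th derivative and leaves a sum
     that is zero by the choice of [r]. *)
  move=> j jM; rewrite rootE /V /comb qderiv_iter_sum horner_sum sl.
  under eq_bigr => m _ do
    rewrite (qderiv_iter_twist _ _ (pprod_logder e l m)) hornerM hy //.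
  by rewrite -mulr_suml -horner_sum r0 // horner0 mul0r.
have sV : (size V <= R + k.+1 * e)%N.
  apply: (leq_trans (size_sum _ _ _)); apply/bigmax_leqP => m _.
  apply: (leq_trans (size_polyMleq _ _)); rewrite size_pprod addnS /= -[X in (_ <= _ + X * _)%N]sl.
  by rewrite leq_add2r.
have := leq_trans (dvdp_leq V0 (dvdp_prod_XsubC_exp uY dV)) sV.
have sP : size (\prod_(y <- Y) ('X - y%:P) ^+ M) = (size Y * M).+1.
  rewrite prodrXl -[LHS]prednK ?size_exp ?size_prod_XsubC //.
  by rewrite size_poly_gt0 expf_neq0 // monic_neq0 // monic_prod_XsubC.
rewrite sP /R addSn ltnS => H.
by move: (N) (size Y * M)%N H eN; clear; nia.
Qed.

End Stepanov.

(** * Agreement of shifted powers on an interval of ['F_p] *)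

Section ShiftedPowers.
Local Open Scope ring_scope.
Variable p : nat.
Hypothesis p_prime : prime p.

Lemma natr_Fp_inj m n : (m < p)%N -> (n < p)%N -> m%:R = n%:R :> 'F_p -> m = n.
Proof.
move=> mp np /(congr1 val); rewrite /= !val_Fp_nat // !modn_small //.
Qed.

Lemma natr_Fp_eq m n : m = n %[mod p] <-> m%:R = n%:R :> 'F_p.
Proof.
split=> [E|/(congr1 val)]; last by rewrite /= !val_Fp_nat.
by apply: val_inj; rewrite /= !val_Fp_nat.
Qed.

Definition shift_pair (s t : nat) (i : nat) : 'F_p * 'F_p := (- (i + s)%:R, - (i + t)%:R).

(** First entries are distinct as there are at most [p] of them; one of them equals a later second
    entry only when [s - t] is a small positive shift. *)
Lemma separated_shift_pairs (s t n m : nat) : (m <= p)%N ->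
  s%:R != t%:R :> 'F_p ->
  (forall i, (0 < i < m)%N -> s%:R != (t + i)%:R :> 'F_p) ->
  separated [seq shift_pair s t i | i <- iota n m].
Proof.
move=> mp st H; elim: m n mp H => [//|m IHm] n mp H /=.
rewrite IHm; [|exact: ltnW|by move=> i /andP[i0 im]; apply: H; rewrite i0 ltnW].
rewrite andbT; apply/andP; split.
  by rewrite eqr_opp !natrD (inj_eq (addrI _)).
rewrite /proots /unzip1 /unzip2 -!map_comp mem_cat negb_or; apply/andP; split; apply/negP.
  case/mapP=> j; rewrite mem_iota /= => /andP[nj jn] /oppr_inj; rewrite !natrD => /addIr E.
  have : (j - n)%:R = 0%:R :> 'F_p by rewrite natrB ?E ?subrr //; apply: ltnW.
  by move/natr_Fp_inj => /(_ _ _)E'; have : (j - n = 0)%N; [apply: E'; lia | lia].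
case/mapP=> j; rewrite mem_iota /= => /andP[nj jn] /oppr_inj E.
have /negP[] := H (j - n)%N ltac:(lia); apply/eqP; apply: (@addrI _ n%:R).
by rewrite -!natrD E; congr (_%:R); lia.
Qed.

Lemma agree_few_roots (e s t B : nat) : (0 < e)%N -> (e < p)%N -> s%:R != t%:R :> 'F_p ->
  (e < 2 ^ B)%N ->
  (forall x, (x < 2 ^ B)%N -> ((x + s) ^ e)%:R = ((x + t) ^ e)%:R :> 'F_p) -> False.
Proof.
move=> e0 ep st eB H.
pose P : {poly 'F_p} := ('X + (s%:R)%:P) ^+ e - ('X + (t%:R)%:P) ^+ e.
have hP x : P.[x] = (x + s%:R) ^+ e - (x + t%:R) ^+ e by rewrite /P !hornerE.
(* At [- s] the first power is zero and the second is not. *)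
have P0 : P != 0.
  apply/eqP => /(congr1 (fun q : {poly 'F_p} => q.[- s%:R])); rewrite hP horner0 addNr.
  rewrite expr0n eqn0Ngt e0 sub0r => /eqP; rewrite oppr_eq0 expf_eq0 e0 /= addrC subr_eq0.
  by rewrite eq_sym (negPf st).
have sP : (size P <= e.+1)%N.
  have XE (c : 'F_p) : 'X + c%:P = 'X - (- c)%:P by rewrite polyCN opprK.
  by apply: (leq_trans (size_polyD _ _)); rewrite size_polyN geq_max !XE !size_exp_XsubC leqnn.
pose Y := [seq x%:R : 'F_p | x <- iota 0 e.+1].
have := @max_poly_roots _ P Y P0.
rewrite size_map size_iota => /(_ _ _)K.
have : (e.+1 < size P)%N; last by move: sP; move: (size P) => z; lia.
apply: K.
  apply/allP => y /mapP[x]; rewrite mem_iota /= ltnS => xe ->.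
  rewrite rootE hP -!natrD -!natrX H ?subrr //; exact: leq_ltn_trans xe eB.
rewrite map_inj_in_uniq ?iota_uniq // => x y; rewrite !mem_iota /= !ltnS => xe ye.
by apply: natr_Fp_inj; [exact: leq_ltn_trans xe ep | exact: leq_ltn_trans ye ep].
Qed.

(** Shifts by up to [k] cost the last [k] points of the interval, at most half of it; hence the
    factor 4 where [stepanov_bound] has 2. *)
Lemma agree_stepanov (e s t B k : nat) : (0 < e)%N -> (2 * e < p)%N ->
  s%:R != t%:R :> 'F_p ->
  (6 * k.+1 * 4 ^ k.+1 <= e)%N -> (2 ^ B <= e)%N -> (2 * k.+1 <= 2 ^ B)%N ->
  (forall i, (0 < i < k.+1)%N -> s%:R != (t + i)%:R :> 'F_p) ->
  (forall x, (x < 2 ^ B)%N -> ((x + s) ^ e)%:R = ((x + t) ^ e)%:R :> 'F_p) ->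
  (2 ^ B * 2 ^ k <= 4 * k.+1 * e)%N.
Proof.
move=> e0 ep st le_e Be kB sep H.
pose l := [seq shift_pair s t i | i <- iota 0 k.+1].
pose Y := [seq x%:R : 'F_p | x <- iota 0 (2 ^ B - k)].
have sY : size Y = (2 ^ B - k)%N by rewrite size_map size_iota.
have Ypow y a b : y \in Y -> (a, b) \in l -> (y - a) ^+ e = (y - b) ^+ e.
  case/mapP=> x; rewrite mem_iota /= => xB -> /mapP[i]; rewrite mem_iota /= => ik [-> ->].
  by rewrite !opprK -!natrD !addnA -!natrX H //; move: (2 ^ B)%N xB; lia.
suff : (size Y * 2 ^ k <= 2 * k.+1 * e)%N.
  by rewrite sY; move: (2 ^ B)%N (2 ^ k)%N kB; clear; nia.
apply: (@stepanov_bound _ p e k l Y) => //.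
- exact: pchar_Fp.
- by rewrite size_map size_iota.
- by apply: separated_shift_pairs => //; move: (2 ^ B)%N kB Be; lia.
- by lia.
- rewrite map_inj_in_uniq ?iota_uniq // => x y; rewrite !mem_iota /= => xB yB.
  by apply: natr_Fp_inj; move: (2 ^ B)%N Be xB yB; lia.
(* If [y] were one entry of a pair, equality of the [e]-th powers would make it the other entry too,
   forcing [s = t]. *)
move=> y yY; apply/negP => yl.
have [a [b [abl yab]]] : exists a b, (a, b) \in l /\ (y = a \/ y = b).
  move: yl; rewrite mem_cat => /orP[] /mapP[[a b] abl ->]; exists a, b; split=> //.
    by left.
  by right.
have ab : a = b.
  have := Ypow y a b yY abl.
  by case: yab => ->; rewrite subrr expr0n eqn0Ngt e0 /= => /esym/eqP;
    rewrite ?[0 == _]eq_sym expf_eq0 e0 /= subr_eq0 => /eqP.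
move: abl ab => /mapP[i _ [-> ->]] /oppr_inj; rewrite !natrD => /addrI E.
by rewrite E eqxx in st.
Qed.

(** For [e < 2 ^ B] root counting suffices. Otherwise the Stepanov bound gives [B + k < l + u + 2],
    where [2 ^ u <= e < 2 ^ u.+1], contrary to the lower bound on [B]. *)
Lemma shifted_powers_differ (e s t L l B : nat) :
  (0 < e)%N -> (2 * e < p)%N -> (s < p)%N -> (t < p)%N -> s != t ->
  (p <= 2 ^ L)%N -> (L <= 2 ^ l)%N -> (L + 3 * l + 8 <= 2 * B)%N ->
  exists2 x, (x < 2 ^ B)%N & ((x + s) ^ e %% p != (x + t) ^ e %% p)%N.
Proof.
move=> e0 ep sp tp st pL Ll LB.
have stF : s%:R != t%:R :> 'F_p by apply: contra st => /eqP/natr_Fp_inj->.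
case: (boolP [exists x : 'I_(2 ^ B), ((x + s) ^ e %% p != (x + t) ^ e %% p)%N]).
  by case/existsP=> x xst; exists x.
move/existsPn=> H0; exfalso.
have H x : (x < 2 ^ B)%N -> ((x + s) ^ e)%:R = ((x + t) ^ e)%:R :> 'F_p.
  by move=> xB; apply/natr_Fp_eq/eqP; have := H0 (Ordinal xB); rewrite negbK.
case: (ltnP e (2 ^ B)) => [eB|Be].
  by apply: (agree_few_roots e0 _ stF eB H); lia.
pose u := trunc_log 2 e.
have [ue eu] : (2 ^ u <= e)%N /\ (e < 2 ^ u.+1)%N.
  by rewrite trunc_logP // trunc_log_ltn.
have uL : (u.+1 < L.+1)%N.
  by rewrite -(ltn_exp2l _ _ (isT : 1 < 2)%N) !expnS; move: (2 ^ u)%N (2 ^ L)%N ue pL; lia.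
have Bu : (B <= u)%N by rewrite -ltnS -(ltn_exp2l _ _ (isT : 1 < 2)%N); apply: leq_ltn_trans Be eu.
(* Essentially the largest [k] with [2 ^ l.+2 * 4 ^ k.+1 <= 2 ^ u]; the power [2 ^ l.+2] dominates
   [6 * k.+1]. *)
pose k := ((u - l - 2)./2).-1.
have k1 : k.+1 = (u - l - 2)./2 by rewrite /k; lia.
have kl : (2 * k.+1 <= 2 ^ l)%N by rewrite k1; move: (2 ^ l)%N Ll; lia.
have le_e : (6 * k.+1 * 4 ^ k.+1 <= e)%N.
  apply: leq_trans ue; rewrite -[4%N]/(2 ^ 2)%N -expnM.
  apply: (@leq_trans (2 ^ l.+2 * 2 ^ (2 * k.+1))%N); last by rewrite -expnD leq_exp2l //; lia.
  by rewrite leq_mul2r; apply/orP; right; rewrite !expnS; move: (2 ^ l)%N kl; clear; lia.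
have kB : (2 * k.+1 <= 2 ^ B)%N by apply: leq_trans kl _; rewrite leq_exp2l //; lia.
have K : (2 ^ B * 2 ^ k <= 4 * k.+1 * e)%N.
  case: (boolP [forall i : 'I_k.+1, (0 < i)%N ==> (s%:R != (t + i)%:R :> 'F_p)]).
    move/forallP=> S; apply: (agree_stepanov e0 ep stF le_e Be kB _ H) => i /andP[i0 ik].
    by have /implyP := S (Ordinal ik); apply.
  move/forallPn=> [i]; rewrite negb_imply negbK => /andP[i0 /eqP Ei].
  (* If [s = t + i] for a small [i], exchanging [s] and [t] restores separation: [t = s + j] would
     give [i + j = 0] modulo [p], although [0 < i + j < p]. *)
  apply: (agree_stepanov (s := t) (t := s) e0 ep _ le_e Be kB _).
  - by rewrite eq_sym.
  - move=> j /andP[j0 jk]; apply/eqP => Ej.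
    have : (i + j)%:R = 0%:R :> 'F_p.
      by move: Ej; rewrite natrD Ei !natrD -addrA -[LHS]addr0 => /addrI <-.
    have ik := ltn_ord i; move/natr_Fp_inj => /(_ _ _) E.
    have : (i + j = 0)%N; last by lia.
    by apply: E; move: (2 ^ B)%N Be kB; lia.
  - by move=> x /H.
move: K; apply/negP; rewrite -ltnNge.
apply: (@leq_trans (2 * 2 ^ l * 2 ^ u.+1)%N).
  apply: (@leq_ltn_trans (2 * 2 ^ l * e)%N).
    by rewrite leq_mul2r; apply/orP; right; move: (2 ^ l)%N kl; clear; lia.
  by rewrite ltn_mul2l muln_gt0 expn_gt0.
by rewrite -expnS -!expnD leq_exp2l //; lia.
Qed.

End ShiftedPowers.

(** * Lengths of binary expansions *)

Lemma nat_to_bits_auxK fuel n : n <= fuel -> bits_to_nat (nat_to_bits_aux fuel n) = n.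
Proof.
elim: fuel n => [|f IHf] n; first by rewrite leqn0 => /eqP->.
move=> nf /=; case: eqP => [-> //|n0] /=; rewrite IHf; last by lia.
by rewrite mul2n odd_double_half.
Qed.

Lemma nat_to_bitsK : cancel nat_to_bits bits_to_nat.
Proof. by move=> n; apply: nat_to_bits_auxK. Qed.

Lemma bits_to_nat_lt l : bits_to_nat l < 2 ^ size l.
Proof. by elim: l => [//|b l IHl] /=; rewrite expnS; case: b; lia. Qed.

Lemma size_nat_to_bits_aux fuel n : 0 < n -> 2 ^ size (nat_to_bits_aux fuel n) <= 2 * n.
Proof.
elim: fuel n => [|f IHf] n n0; first by rewrite expn0 /=; lia.
rewrite /=; case: eqP => [|_] /=; first by lia.
have [h0|h0] := posnP n./2; last by have := IHf _ h0; rewrite expnS; lia.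
rewrite h0; case: f {IHf} => [|f] /=; by lia.
Qed.

Lemma ltn_exp_size_bits n : n < 2 ^ size (nat_to_bits n).
Proof. by rewrite -{1}(nat_to_bitsK n) bits_to_nat_lt. Qed.

Lemma leq_exp_size_bits n : 0 < n -> 2 ^ size (nat_to_bits n) <= 2 * n.
Proof. exact: size_nat_to_bits_aux. Qed.

Lemma size_nat_to_bits_le m n : m < n -> size (nat_to_bits m) <= size (nat_to_bits n).
Proof.
move=> mn; have [->//|m0] := posnP m.
rewrite -ltnS -(ltn_exp2l _ _ (isT : 1 < 2)) expnS.
by have := leq_exp_size_bits m0; have := ltn_exp_size_bits n; lia.
Qed.

(** * The Turing machine *)

(* Tape 1 holds the queried x, tape 3 the width B in unary, tape 5 a copy of the first
   answer; a mark on tape 0 tells in [Answered] and [RewindCopy] which oracle was asked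
   last. [Scan par dir] reads the input bit by bit while the head of tape 4 sweeps back
   and forth ([dir = true]: to the right) over a block of marks which grows by one mark
   per round trip; [par] is the parity of the number of bits read. [Append] writes on
   tape 3 the 8 marks due when the block grows. *)
Inductive state :=
  | Start | Scan of bool & bool | Append of bool & 'I_8
  | Ask1 | Ask2 | Answered | Copy | RewindCopy | Compare | RewindWidth
  | Carry | NoCarry | Accept | Reject.

Definition state_code := (bool * bool + bool * 'I_8 + 'I_12)%type.

Definition encode_state (q : state) : state_code :=
  match q with
  | Scan a b => inl (inl (a, b))
  | Append a j => inl (inr (a, j))
  | Start => inr (inord 0) | Ask1 => inr (inord 1) | Ask2 => inr (inord 2)
  | Answered => inr (inord 3) | Copy => inr (inord 4) | RewindCopy => inr (inord 5)
  | Compare => inr (inord 6) | RewindWidth => inr (inord 7) | Carry => inr (inord 8)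
  | NoCarry => inr (inord 9) | Accept => inr (inord 10) | Reject => inr (inord 11)
  end.

Definition decode_state (c : state_code) : state :=
  match c with
  | inl (inl (a, b)) => Scan a b
  | inl (inr (a, j)) => Append a j
  | inr i => nth Start [:: Start; Ask1; Ask2; Answered; Copy; RewindCopy; Compare;
                           RewindWidth; Carry; NoCarry; Accept; Reject] i
  end.

Lemma encode_stateK : cancel encode_state decode_state.
Proof. by case=> //= *; rewrite inordK. Qed.

HB.instance Definition _ := Finite.copy state (can_type encode_stateK).

Definition transition (q : state) (r0 r1 r2 r3 r4 r5 : Sym) : state * seq (Sym * Mv) :=
  let k r := (r, MvS) in
  let idle := [:: k r0; k r1; k r2; k r3; k r4; k r5] in
  match q with
  | Start => (Scan false true,
      [:: k r0; k r1; k r2; (r3, MvR); (r4, MvR); (r5, MvR)])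
  | Scan par dir =>
      if r0 is None then (Ask1, idle) else
      let a3 := if par then (Some true, MvR) else k r3 in
      match dir, r4 with
      | true, Some _ => (Scan (~~ par) true,
          [:: (r0, MvR); k r1; k r2; a3; (r4, MvR); k r5])
      | true, None => (Append (~~ par) ord0,
          [:: (r0, MvR); k r1; k r2; a3; (Some true, MvL); k r5])
      | false, Some _ => (Scan (~~ par) false,
          [:: (r0, MvR); k r1; k r2; a3; (r4, MvL); k r5])
      | false, None => (Scan (~~ par) true,
          [:: (r0, MvR); k r1; k r2; a3; (r4, MvR); k r5])
      end
  | Append par j =>
      (if j == ord_max then Scan par false else Append par (inord j.+1),
       [:: k r0; k r1; k r2; (Some true, MvR); k r4; k r5])
  | Answered =>
      if r0 is None then
        (Copy, [:: (Some true, MvS); k r1; k r2; k r3; k r4; k r5])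
      else (Compare, [:: (None, MvS); k r1; k r2; k r3; k r4; k r5])
  | Copy =>
      if r2 is None then
        (RewindCopy, [:: k r0; k r1; k r2; k r3; k r4; (None, MvL)])
      else (Copy, [:: k r0; k r1; (r2, MvR); k r3; k r4; (r2, MvR)])
  | RewindCopy =>
      if r5 is None then
        if r0 is None then
          (RewindWidth, [:: k r0; k r1; k r2; (r3, MvL); k r4; (r5, MvR)])
        else (Ask2, [:: k r0; k r1; k r2; k r3; k r4; (r5, MvR)])
      else (RewindCopy, [:: k r0; k r1; k r2; k r3; k r4; (r5, MvL)])
  | Compare =>
      if r2 == r5 then
        if r2 is None then (RewindCopy, [:: k r0; k r1; k r2; k r3; k r4; (r5, MvL)])
        else (Compare, [:: k r0; k r1; (r2, MvR); k r3; k r4; (r5, MvR)])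
      else (Reject, idle)
  | RewindWidth =>
      if r3 is None then (Carry, [:: k r0; k r1; k r2; (r3, MvR); k r4; k r5])
      else (RewindWidth, [:: k r0; (r1, MvL); k r2; (r3, MvL); k r4; k r5])
  | Carry =>
      if r3 is None then (Accept, idle) else
      if r1 == Some true then
        (Carry, [:: k r0; (Some false, MvR); k r2; (r3, MvR); k r4; k r5])
      else (NoCarry, [:: k r0; (Some true, MvR); k r2; (r3, MvR); k r4; k r5])
  | NoCarry =>
      if r3 is None then (Ask1, idle)
      else (NoCarry, [:: k r0; (r1, MvR); k r2; (r3, MvR); k r4; k r5])
  | _ => (q, idle)
  end.

Definition machine : OTM :=
  {| ntapes := 3; st := state;
     q_start := Start; q_acc := Accept; q_rej := Reject;
     q_ask1 := Ask1; q_ask2 := Ask2; q_ret := Answered;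
     delta := fun q rd =>
       let r i (h : i < 6) := rd (Ordinal h) in
       let: (q', acts) := transition q (@r 0 isT) (@r 1 isT) (@r 2 isT)
                                       (@r 3 isT) (@r 4 isT) (@r 5 isT) in
       (q', fun i : 'I_6 => nth (None, MvS) acts i) |}.

Definition cfg (q : state) (t0 t1 t2 t3 t4 t5 : tape) : config machine :=
  (q, fun i : 'I_6 => nth blank_tape [:: t0; t1; t2; t3; t4; t5] i).

Definition act (t : tape) (a : Sym * Mv) : tape := twrite_move t a.1 a.2.

Lemma ord6P (T : Type) (g1 g2 : 'I_6 -> T) :
  (forall i (h : i < 6), g1 (Ordinal h) = g2 (Ordinal h)) -> g1 = g2.
Proof. by move=> E; apply: functional_extensionality => -[i h]. Qed.

(** * Single steps and step counting *)

Section Steps.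
Variables (f1 f2 : nat -> nat).

Local Notation step := (@step machine f1 f2).

Definition active (q : state) : bool :=
  match q with Accept | Reject | Ask1 | Ask2 => false | _ => true end.

Lemma step_active q t0 t1 t2 t3 t4 t5 : active q ->
  step (cfg q t0 t1 t2 t3 t4 t5) =
  let: (q', acts) := transition q (tread t0) (tread t1) (tread t2)
                                  (tread t3) (tread t4) (tread t5) in
  let a i := nth (None, MvS) acts i in
  cfg q' (act t0 (a 0)) (act t1 (a 1)) (act t2 (a 2)) (act t3 (a 3)) (act t4 (a 4))
         (act t5 (a 5)).
Proof.
move=> aq; rewrite /step /cfg.
have [-> -> -> ->] : [/\ q == q_acc machine = false, q == q_rej machine = false,
    q == q_ask1 machine = false & q == q_ask2 machine = false].
  by split; apply/eqP => E; move: aq; rewrite E.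
rewrite /=; case: (transition _ _ _ _ _ _ _) => q' acts; congr pair; apply: ord6P.
by case=> [|[|[|[|[|[|]]]]]].
Qed.

Lemma inord2 : inord 2 = @Ordinal 6 2 isT.
Proof. by apply: val_inj; rewrite /= inordK. Qed.

Lemma inord1 : inord 1 = @Ordinal 6 1 isT.
Proof. by apply: val_inj; rewrite /= inordK. Qed.

Definition answer (a : nat) := tape_of_syms (map Some (nat_to_bits a)).

Lemma step_ask1 t0 t1 t2 t3 t4 t5 :
  step (cfg Ask1 t0 t1 t2 t3 t4 t5) = cfg Answered t0 t1 (answer (f1 (query t1))) t3 t4 t5.
Proof.
rewrite /step /cfg.
have [-> -> ->] : [/\ Ask1 == q_acc machine = false, Ask1 == q_rej machine = false &
  Ask1 == q_ask1 machine] by split; [apply/eqP | apply/eqP | apply/eqP].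
congr pair; apply: ord6P; rewrite inord1 inord2.
by case=> [|[|[|[|[|[|]]]]]].
Qed.

Lemma step_ask2 t0 t1 t2 t3 t4 t5 :
  step (cfg Ask2 t0 t1 t2 t3 t4 t5) = cfg Answered t0 t1 (answer (f2 (query t1))) t3 t4 t5.
Proof.
rewrite /step /cfg.
have [-> -> -> ->] : [/\ Ask2 == q_acc machine = false, Ask2 == q_rej machine = false,
  Ask2 == q_ask1 machine = false & Ask2 == q_ask2 machine].
  by split; [apply/eqP | apply/eqP | apply/eqP | apply/eqP].
congr pair; apply: ord6P; rewrite inord1 inord2.
by case=> [|[|[|[|[|[|]]]]]].
Qed.

Lemma act_keep c h m :
  act (Tape c h) (c h, m) =
  Tape c match m with MvL => h.-1 | MvR => h.+1 | MvS => h end.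
Proof.
by congr Tape; apply: functional_extensionality => i; case: eqP => [->|].
Qed.

Lemma act_idle t : act t (tread t, MvS) = t.
Proof. by case: t => c h; apply: act_keep. Qed.

Definition within N (c c' : config machine) := exists2 n, n <= N & iter n step c = c'.

Lemma within_refl N c : within N c c.
Proof. by exists 0. Qed.

Lemma within_step N c c1 c' : step c = c1 -> within N c1 c' -> within N.+1 c c'.
Proof. by move=> E [n nN <-]; exists n.+1; rewrite // iterSr E. Qed.

Lemma within_trans N1 N2 c1 c2 c3 : within N1 c1 c2 -> within N2 c2 c3 ->
  within (N1 + N2) c1 c3.
Proof.
by move=> [n n1 <-] [m m2 <-]; exists (m + n); rewrite ?iterD // addnC leq_add.
Qed.

Lemma within_le N1 N2 c c' : N1 <= N2 -> within N1 c c' -> within N2 c c'.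
Proof. by move=> l12 [n n1 <-]; exists n => //; apply: leq_trans l12. Qed.

(** Cell 0 stays blank, so that a head moving left recognises the end of the block. *)
Definition marks m h := Tape (fun i => if 0 < i <= m then Some true else None) h.

Lemma act_marks m h mv :
  act (marks m h) (tread (marks m h), mv) =
  marks m match mv with MvL => h.-1 | MvR => h.+1 | MvS => h end.
Proof. exact: act_keep. Qed.

End Steps.

(** * The phases of a run and their durations *)

Section Run.
Variables (f1 f2 : nat -> nat).
Local Notation step := (@step machine f1 f2).
Local Notation within := (@within f1 f2).
Lemma act_mark m mv :
  act (marks m m.+1) (Some true, mv) =
  marks m.+1 match mv with MvL => m | MvR => m.+2 | MvS => m.+1 end.
Proof.
rewrite /act /twrite_move /marks /=; congr Tape; apply: functional_extensionality => i.
rewrite (leq_eqVlt i m.+1) ltnS.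
by case: eqVneq => //= ->.
Qed.

Lemma append_phase par (j : 'I_8) m t0 t1 t2 t4 t5 :
  within (8 - j) (cfg (Append par j) t0 t1 t2 (marks m m.+1) t4 t5)
    (cfg (Scan par false) t0 t1 t2 (marks (m + (8 - j)) (m + (8 - j)).+1) t4 t5).
Proof.
have [n En] : exists n, 8 - j = n.+1 by exists (7 - j); have := ltn_ord j; lia.
elim: n j m En => [|n IHn] j m En; rewrite En;
  apply: (within_step (step_active _ _ _ _ _ _ _ _ (isT : active (Append par j))));
  cbn [transition nth]; rewrite !act_idle act_mark.
  have jE : j = ord_max by apply: val_inj => /=; lia.
  rewrite jE eqxx addn1; exact: within_refl.
rewrite ifN; last by rewrite -(inj_eq val_inj) /=; lia.
have jlt : j.+1 < 8 by lia.
have := IHn (inord j.+1) m.+1; rewrite inordK // => K.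
have E1 : 8 - j.+1 = n.+1 by lia.
by rewrite -addSnnS -E1; apply: K.
Qed.

Lemma act_id t r : tread t = r -> act t (r, MvS) = t.
Proof. by move=> <-; apply: act_idle. Qed.

(** Growing the block to [j] marks takes a round trip of [2 * j] symbols, so [w * w.+1] symbols are
    read when the head is back at cell 1 with [w] marks. In both directions
    [w * w <= i < w.+1 * w.+1]. *)
Definition sweep_ok (i w h : nat) (dir : bool) :=
  if dir then (0 < h <= w.+1) && (i.+1 == w * w.+1 + h)
  else (h < w) && (h + i.+1 == w * w.+1).

Definition scan_cfg c0 i w h dir t1 t2 t5 :=
  cfg (Scan (odd i) dir) (Tape c0 i) t1 t2
    (marks (i./2 + w * 8) (i./2 + w * 8).+1) (marks w h) t5.

Lemma tread_marks m h : tread (marks m h) = if 0 < h <= m then Some true else None.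
Proof. by []. Qed.

(** One step reads the symbol; eight more occur when the block grows and [Append] runs. *)
Lemma scan_step c0 i w h dir b t1 t2 t5 : c0 i = Some b -> sweep_ok i w h dir ->
  exists w' h' dir', sweep_ok i.+1 w' h' dir' /\
    within 9 (scan_cfg c0 i w h dir t1 t2 t5) (scan_cfg c0 i.+1 w' h' dir' t1 t2 t5).
Proof.
move=> c0i ok.
have mark3 : act (marks (i./2 + w * 8) (i./2 + w * 8).+1)
    (if odd i then (Some true, MvR)
     else (tread (marks (i./2 + w * 8) (i./2 + w * 8).+1), MvS)) =
    marks (i.+1./2 + w * 8) (i.+1./2 + w * 8).+1.
  case: ifP => oi; rewrite ?act_mark ?act_marks.
    by rewrite (_ : i.+1./2 = i./2.+1) //; lia.
  by rewrite (_ : i.+1./2 = i./2) //; lia.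
have act0 : act (Tape c0 i) (Some b, MvR) = Tape c0 i.+1 by rewrite -c0i act_keep.
have S1 := step_active f1 f2 (Tape c0 i) t1 t2 (marks (i./2 + w * 8) (i./2 + w * 8).+1)
  (marks w h) t5 (isT : active (Scan (odd i) dir)).
move: S1; rewrite [tread (Tape c0 i)]/= c0i.
case: dir ok; rewrite /sweep_ok => /andP[h1 /eqP ih]; cbn [transition].
  have [hw|hw] : h <= w \/ h = w.+1 by lia.
    have r4 : tread (marks w h) = Some true by rewrite tread_marks hw; case/andP: h1 => ->.
    rewrite {1}r4; cbn [nth]; rewrite act0 !act_idle mark3 act_marks => S1.
    exists w, h.+1, true; split; first by rewrite /=; lia.
    by apply: within_step S1 _; exact: within_refl.
  have r4 : tread (marks w h) = None by rewrite tread_marks hw ltnn.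
  rewrite {1}r4; cbn [nth]; rewrite hw act0 !act_idle mark3 act_mark => S1.
  exists w.+1, w, false; split; first by rewrite /=; nia.
  apply: within_step S1 _; have := append_phase (~~ odd i) ord0 (i.+1./2 + w * 8).
  rewrite subn0 (_ : i.+1./2 + w * 8 + 8 = i.+1./2 + w.+1 * 8); last by lia.
  exact.
have [h0|h0] := posnP h.
  have r4 : tread (marks w h) = None by rewrite tread_marks h0.
  rewrite {1}r4; cbn [nth]; rewrite h0 act0 !act_idle mark3 act_marks => S1.
  exists w, 1, true; split; first by rewrite /=; nia.
  by apply: within_step S1 _; exact: within_refl.
have r4 : tread (marks w h) = Some true by rewrite tread_marks h0 ltnW.
rewrite {1}r4; cbn [nth]; rewrite act0 !act_idle mark3 act_marks => S1.
exists w, h.-1, false; split; first by rewrite /=; lia.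
by apply: within_step S1 _; exact: within_refl.
Qed.

Lemma scan_phase c0 L t1 t2 t5 : (forall i, i < L -> c0 i != None) -> c0 L = None ->
  exists w h dir, sweep_ok L w h dir /\
    within (9 * L + 1) (scan_cfg c0 0 0 1 true t1 t2 t5)
      (cfg Ask1 (Tape c0 L) t1 t2 (marks (L./2 + w * 8) (L./2 + w * 8).+1) (marks w h) t5).
Proof.
move=> c0s c0L.
suff H i : i <= L -> exists w h dir, sweep_ok i w h dir /\
    within (9 * i) (scan_cfg c0 0 0 1 true t1 t2 t5) (scan_cfg c0 i w h dir t1 t2 t5).
  have [w [h [dir [ok W]]]] := H L (leqnn L).
  exists w, h, dir; split=> //; apply: within_trans W _.
  have := step_active f1 f2 (Tape c0 L) t1 t2 (marks (L./2 + w * 8) (L./2 + w * 8).+1)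
    (marks w h) t5 (isT : active (Scan (odd L) dir)).
  rewrite [tread (Tape c0 L)]/= c0L; cbn [transition nth].
  rewrite (act_id (c0L : tread (Tape c0 L) = None)) !act_idle => S1.
  by apply: within_step S1 _; exact: within_refl.
elim: i => [|i IHi] iL; first by exists 0, 1, true; split=> //; exact: within_refl.
have [w [h [dir [ok W]]]] := IHi (ltnW iL).
case E: (c0 i) (c0s _ iL) => [b|//] _.
have [w' [h' [dir' [ok' W']]]] := scan_step t1 t2 t5 E ok.
exists w', h', dir'; split=> //; rewrite mulnS addnC; exact: within_trans W W'.
Qed.

Definition bits_tape (s : seq bool) (h : nat) := Tape (nth (None : Sym) (map Some s)) h.

(** The copy is shifted by one to keep cell 0 blank. At [n = (size s).+1] it includes the closing
    blank, which cuts off remains of a longer earlier copy. *)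
Definition copied (s : seq bool) (n : nat) (c : nat -> Sym) :=
  c 0 = None /\ forall i, i < n -> c i.+1 = nth (None : Sym) (map Some s) i.

Ltac machine_step :=
  apply: within_step; [apply: step_active; exact: isT | cbn [transition]].

Lemma act_read t r m : tread t = r ->
  act t (r, m) =
  Tape (tcont t) match m with MvL => (thead t).-1 | MvR => (thead t).+1 | MvS => thead t end.
Proof. by move=> <-; case: t => c h; apply: act_keep. Qed.

Lemma nth_Some s i : i < size s -> exists b, nth (None : Sym) (map Some s) i = Some b.
Proof. by move=> h; exists (nth false s i); rewrite (nth_map false). Qed.

Lemma copy_phase s j c t0 t1 t3 t4 : j <= size s -> copied s j c ->
  exists c', copied s (size s).+1 c' /\
    within (size s - j).+1
      (cfg Copy t0 t1 (bits_tape s j) t3 t4 (Tape c j.+1))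
      (cfg RewindCopy t0 t1 (bits_tape s (size s)) t3 t4 (Tape c' (size s))).
Proof.
move En : (size s - j) => n; elim: n j c En => [|n IHn] j c En js [c0 cs].
  have jE : j = size s by lia.
  rewrite jE in cs *.
  have r2 : tread (bits_tape s (size s)) = None by rewrite /= nth_default ?size_map.
  exists (tcont (act (Tape c (size s).+1) (None, MvL))); split.
    split=> [|i] /=; first by rewrite c0.
    rewrite ltnS leq_eqVlt eqSS => /orP[/eqP->|lt].
      by rewrite eqxx nth_default ?size_map.
    by rewrite (ltn_eqF lt) cs.
  machine_step; rewrite {1}r2; cbn [nth]; rewrite !act_idle; exact: within_refl.
have [b Eb] := nth_Some (ltac:(lia) : j < size s).
have r2 : tread (bits_tape s j) = Some b by [].
have := IHn j.+1 (tcont (act (Tape c j.+1) (Some b, MvR))).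
case; [lia | lia | |] => [|c' [cc' W]].
  split=> [|i] /=; first by rewrite c0.
  rewrite ltnS leq_eqVlt eqSS => /orP[/eqP->|lt]; first by rewrite eqxx.
  by rewrite (ltn_eqF lt) cs.
exists c'; split=> //; machine_step; rewrite !r2; cbn [nth].
by rewrite !act_idle (act_read _ r2).
Qed.

Lemma rewind_copy s c j t0 t1 t2 t3 t4 : j <= size s -> copied s (size s).+1 c ->
  within j (cfg RewindCopy t0 t1 t2 t3 t4 (Tape c j))
           (cfg RewindCopy t0 t1 t2 t3 t4 (Tape c 0)).
Proof.
move=> js [c0 cs]; elim: j js => [|j IHj] js; first exact: within_refl.
have [b Eb] := nth_Some js.
have r5 : tread (Tape c j.+1) = Some b by rewrite /= cs // ltnW.
machine_step; rewrite {1}r5; cbn [nth]; rewrite !act_idle act_read //.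
by apply: IHj; apply: ltnW.
Qed.

Lemma compare_eq s2 pre c t0 t1 t3 t4 : copied (pre ++ s2) (size (pre ++ s2)).+1 c ->
  within (size s2).+1
    (cfg Compare t0 t1 (bits_tape (pre ++ s2) (size pre)) t3 t4 (Tape c (size pre).+1))
    (cfg RewindCopy t0 t1 (bits_tape (pre ++ s2) (size (pre ++ s2))) t3 t4
      (Tape c (size (pre ++ s2)))).
Proof.
elim: s2 pre => [|b s IHs] pre [c0 cs].
  rewrite cats0 in cs *.
  have r2 : tread (bits_tape pre (size pre)) = None by rewrite /= nth_default ?size_map.
  have r5 : tread (Tape c (size pre).+1) = None by rewrite /= cs.
  machine_step; rewrite r2 {1}r5; cbn [nth eq_op]; rewrite eqxx; cbn [nth].
  rewrite !act_idle (act_id r2) act_read //; exact: within_refl.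
have r2 : tread (bits_tape (pre ++ b :: s) (size pre)) = Some b.
  by rewrite /= map_cat nth_cat size_map ltnn subnn.
have r5 : tread (Tape c (size pre).+1) = Some b.
  by rewrite /= cs // size_cat /=; lia.
machine_step; rewrite r2 {1}r5; cbn [nth eq_op]; rewrite eqxx; cbn [nth].
rewrite !act_idle (act_read _ r2) act_read //.
have := IHs (rcons pre b); rewrite size_rcons cat_rcons; apply; by split.
Qed.

(** Here [pre] is the part already found equal. If one word is a prefix of the other, its closing
    blank reveals the difference, so the first answer alone bounds the time. *)
Lemma compare_neq s1 s2 pre c t0 t1 t3 t4 : s1 != s2 ->
  copied (pre ++ s1) (size (pre ++ s1)).+1 c ->
  exists2 c', c'.1 = Reject &
  within (size s1).+1
    (cfg Compare t0 t1 (bits_tape (pre ++ s2) (size pre)) t3 t4 (Tape c (size pre).+1)) c'.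
Proof.
have stop w2 w5 n : tread w2 != tread w5 -> exists2 c', c'.1 = Reject &
    within n.+1 (cfg Compare t0 t1 w2 t3 t4 w5) c'.
  move=> r25; exists (cfg Reject t0 t1 w2 t3 t4 w5) => //.
  by machine_step; rewrite (negPf r25); cbn [nth]; rewrite !act_idle; exact: within_refl.
have rd s : nth (None : Sym) [seq Some i | i <- pre ++ s] (size pre) =
    nth (None : Sym) (map Some s) 0.
  by rewrite map_cat nth_cat size_map ltnn subnn.
have lt s : size pre < (size (pre ++ s)).+1 by rewrite size_cat; lia.
elim: s1 s2 pre rd lt => [|b1 s1 IHs] [|b2 s2] pre rd lt // s12 [c0 cs].
- by apply: stop; rewrite /= (cs _ (lt _)) !rd.
- by apply: stop; rewrite /= (cs _ (lt _)) !rd.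
have [b12|b12] := eqVneq b1 b2; last first.
  apply: stop; rewrite /= (cs _ (lt _)) !rd /=.
  by apply: contra b12 => /eqP[->].
rewrite -{b2}b12 in s12 *.
have r2 : tread (bits_tape (pre ++ b1 :: s2) (size pre)) = Some b1 by rewrite /= rd.
have r5 : tread (Tape c (size pre).+1) = Some b1 by rewrite /= (cs _ (lt _)) rd.
have := IHs s2 (rcons pre b1); rewrite size_rcons !cat_rcons; case.
- by move=> s'; rewrite map_cat nth_cat size_map size_rcons ltnn subnn.
- by move=> s'; rewrite size_cat size_rcons; lia.
- by apply: contra s12 => /eqP->.
- by split.
move=> c' c'R W; exists c' => //; machine_step.
rewrite r2 {1}r5; cbn [nth eq_op]; rewrite eqxx; cbn [nth].
by rewrite !act_idle (act_read _ r2) act_read.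
Qed.

(** The head of tape 1 may start left of the head of tape 3, as in the first round; it then waits at
    cell 0, where a left move has no effect. *)
Lemma rewind_width B m h c t0 t2 t4 t5 : m <= B -> h <= m ->
  within m.+1 (cfg RewindWidth t0 (Tape c h) t2 (marks B m) t4 t5)
              (cfg Carry t0 (Tape c 0) t2 (marks B 1) t4 t5).
Proof.
elim: m h => [|m IHm] h mB hm; machine_step.
  have -> : h = 0 by lia.
  have r3 : tread (marks B 0) = None by [].
  by rewrite {1}r3; cbn [nth]; rewrite act_marks !act_idle; exact: within_refl.
have r3 : tread (marks B m.+1) = Some true by rewrite tread_marks mB.
rewrite {1}r3; cbn [nth]; rewrite act_marks act_keep !act_idle.
by apply: IHm; lia.
Qed.

(** Blanks count as digits 0, so the initially blank query tape already represents 0. *)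
Definition bitval (c : nat -> Sym) i r := bits_to_nat [seq c j == Some true | j <- iota i r].

Lemma bitvalS c i r : bitval c i r.+1 = (c i == Some true) + 2 * bitval c i.+1 r.
Proof. by []. Qed.

Lemma eq_bitval c c' i r : (forall j, i <= j < i + r -> c j = c' j) ->
  bitval c i r = bitval c' i r.
Proof.
move=> E; rewrite /bitval; congr bits_to_nat; apply/eq_in_map => j.
by rewrite mem_iota => /E->.
Qed.

Lemma no_carry_phase B r i c t0 t2 t4 t5 : r + i = B ->
  within r.+1 (cfg NoCarry t0 (Tape c i) t2 (marks B i.+1) t4 t5)
              (cfg Ask1 t0 (Tape c B) t2 (marks B B.+1) t4 t5).
Proof.
elim: r i => [|r IHr] i ri; machine_step.
  rewrite add0n in ri; rewrite ri.
  have r3 : tread (marks B B.+1) = None by rewrite tread_marks ltnn.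
  by rewrite {1}r3; cbn [nth]; rewrite !act_idle; exact: within_refl.
have r3 : tread (marks B i.+1) = Some true by rewrite tread_marks; case: ifP => //; lia.
by rewrite {1}r3; cbn [nth]; rewrite act_marks act_keep !act_idle; apply: IHr; lia.
Qed.

(** Incrementing the counter: the marks run out before the carry is absorbed exactly when all [r]
    digits are 1. Agreement below [i] lets the induction keep the digit just reset. *)
Lemma carry_phase B r i c t0 t2 t4 t5 : r + i = B ->
  if (bitval c i r).+1 == 2 ^ r then
    exists2 c', c'.1 = Accept &
      within r.+1 (cfg Carry t0 (Tape c i) t2 (marks B i.+1) t4 t5) c'
  else exists c', [/\ forall j, j < i -> c' j = c j, bitval c' i r = (bitval c i r).+1 &
      within r.+1 (cfg Carry t0 (Tape c i) t2 (marks B i.+1) t4 t5)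
                  (cfg Ask1 t0 (Tape c' B) t2 (marks B B.+1) t4 t5)].
Proof.
elim: r i c => [|r IHr] i c ri.
  rewrite add0n in ri; rewrite ri /=.
  have r3 : tread (marks B B.+1) = None by rewrite tread_marks ltnn.
  exists (cfg Accept t0 (Tape c B) t2 (marks B B.+1) t4 t5) => //.
  by machine_step; rewrite {1}r3; cbn [nth]; rewrite !act_idle; exact: within_refl.
have r3 : tread (marks B i.+1) = Some true by rewrite tread_marks; case: ifP => //; lia.
have ri1 : r + i.+1 = B by lia.
rewrite bitvalS expnS; case: (eqVneq (c i) (Some true)) => ci.
  have W c' : within r.+1 (cfg Carry t0 (act (Tape c i) (Some false, MvR)) t2
        (marks B i.+2) t4 t5) c' ->
      within r.+2 (cfg Carry t0 (Tape c i) t2 (marks B i.+1) t4 t5) c'.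
    move=> W; machine_step; rewrite {1}r3 [tread (Tape c i)]/= ci eqxx; cbn [nth].
    by rewrite act_marks !act_idle.
  set d := tcont (act (Tape c i) (Some false, MvR)).
  have vd : bitval d i.+1 r = bitval c i.+1 r.
    by apply: eq_bitval => j /andP[ij _]; rewrite /d /= (gtn_eqF ij).
  have := IHr i.+1 d ri1; rewrite vd; move: (2 ^ r) (bitval c i.+1 r) => N v.
  rewrite (_ : (true + 2 * v).+1 == 2 * N = (v.+1 == N)); last by apply/eqP/eqP; lia.
  case: ifP => _ [c']; first by move=> c'A Wc; exists c' => //; apply: W.
  case=> agree v' Wc; exists c'; split; last exact: W.
    by move=> j ji; rewrite agree ?ltnS ?(ltnW ji) // /d /= (ltn_eqF ji).
  by rewrite bitvalS v' agree // /d /= eqxx /=; lia.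
rewrite add0n ifN; last by apply/eqP; lia.
exists (tcont (act (Tape c i) (Some true, MvR))); split.
- by move=> j ji; rewrite /= (ltn_eqF ji).
- rewrite bitvalS /= eqxx; congr (_ + 2 * _).
  by apply: eq_bitval => j /andP[ij _]; rewrite (gtn_eqF ij).
machine_step; rewrite {1}r3 [tread (Tape c i)]/= (negPf ci); cbn [nth].
rewrite act_marks !act_idle.
exact: no_carry_phase.
Qed.

Definition loop_cfg c0 L c1 h1 t2 B t4 c5 :=
  cfg Ask1 (Tape c0 L) (Tape c1 h1) t2 (marks B B.+1) t4 (Tape c5 1).

Lemma ask_phase c0 L c1 h1 t2 B t4 c5 S (s1 := nat_to_bits (f1 (query (Tape c1 h1))))
    (s2 := nat_to_bits (f2 (query (Tape c1 h1)))) :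
  c0 L = None -> c5 0 = None -> size s1 <= S ->
  exists2 c, copied s1 (size s1).+1 c &
    within (2 * S + 6) (loop_cfg c0 L c1 h1 t2 B t4 c5)
      (cfg Compare (Tape c0 L) (Tape c1 h1) (bits_tape s2 0) (marks B B.+1) t4 (Tape c 1)).
Proof.
move=> c0L c50 sS.
have r0 : tread (Tape c0 L) = None by [].
set T1 := Tape c1 h1; set T3 := marks B B.+1.
pose T0 := act (Tape c0 L) (Some true, MvS).
have rT0 : tread T0 = Some true by rewrite /tread /= eqxx.
have unflag : act T0 (None, MvS) = Tape c0 L.
  congr Tape; apply: functional_extensionality => i /=.
  by case: eqP => [->|].
have [|c [cc Wc]] := @copy_phase s1 0 c5 T0 T1 T3 t4 (leq0n _); first by split.
have cc0 : tread (Tape c 0) = None by case: cc.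
exists c => //.
apply: (@within_le _ _ (2 + ((size s1).+1 + (size s1 + 3)))).
  by move: (size s1) sS; clear; lia.
apply: (@within_trans _ _ 2 _ _ (cfg Copy T0 T1 (bits_tape s1 0) T3 t4 (Tape c5 1))).
  apply: within_step (step_ask1 _ _ _ _ _ _ _ _) _.
  by machine_step; rewrite {1}r0; cbn [nth]; rewrite !act_idle; exact: within_refl.
rewrite subn0 in Wc; apply: within_trans Wc _.
apply: within_trans (rewind_copy _ _ _ _ _ (leqnn _) cc) _.
machine_step; rewrite cc0 {1}rT0; cbn [nth]; rewrite (act_read _ cc0) !act_idle.
apply: within_step (step_ask2 _ _ _ _ _ _ _ _) _.
machine_step; rewrite {1}rT0; cbn [nth]; rewrite unflag !act_idle; exact: within_refl.
Qed.

(** The query and the [B]-digit counter are tracked separately: in the first round the head is at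
    cell 0 and the query is the empty word, later the head is at [B]. *)
Lemma iteration c0 L c1 h1 t2 B t4 c5 S x :
  c0 L = None -> c5 0 = None -> size (nat_to_bits (f1 x)) <= S ->
  h1 <= B -> query (Tape c1 h1) = x -> bitval c1 0 B = x ->
  let K := 4 * S + 2 * B + 10 in
  if f1 x != f2 x then
    exists2 c', c'.1 = Reject & within K (loop_cfg c0 L c1 h1 t2 B t4 c5) c'
  else if x.+1 == 2 ^ B then
    exists2 c', c'.1 = Accept & within K (loop_cfg c0 L c1 h1 t2 B t4 c5) c'
  else exists c1' t2' c5', [/\ c5' 0 = None, bitval c1' 0 B = x.+1 &
    within K (loop_cfg c0 L c1 h1 t2 B t4 c5) (loop_cfg c0 L c1' B t2' B t4 c5')].
Proof.
move=> c0L c50 sS hB Ex vx K.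
have [c cc Wc] := @ask_phase c0 L c1 h1 t2 B t4 c5 S c0L c50 ltac:(by rewrite Ex).
rewrite Ex in cc Wc; set s1 := nat_to_bits (f1 x) in sS cc Wc.
set s2 := nat_to_bits (f2 x) in Wc.
case: ifP => [f12|/negbFE/eqP f12].
  have s12 : s1 != s2 by apply: contra f12 => /eqP/(can_inj nat_to_bitsK)->.
  have [c' c'R W'] :=
    @compare_neq s1 s2 [::] c (Tape c0 L) (Tape c1 h1) (marks B B.+1) t4 s12 cc.
  exists c' => //; apply: within_le (within_trans Wc W').
  by rewrite /K; move: (size s1) sS; clear; lia.
rewrite /s2 -f12 -/s1 in Wc.
have cr : tread (Tape c 0) = None by case: cc.
have W : within (4 * S + B + 9) (loop_cfg c0 L c1 h1 t2 B t4 c5)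
    (cfg Carry (Tape c0 L) (Tape c1 0) (bits_tape s1 (size s1)) (marks B 1) t4 (Tape c 1)).
  apply: (@within_le _ _ (2 * S + 6 + ((size s1).+1 + (size s1 + B.+2)))).
    by move: (size s1) sS; clear; lia.
  apply: within_trans Wc _; apply: within_trans (@compare_eq s1 [::] c _ _ _ _ cc) _.
  apply: within_trans (rewind_copy _ _ _ _ _ (leqnn _) cc) _.
  have r0 : tread (Tape c0 L) = None by [].
  machine_step; rewrite cr {1}r0; cbn [nth]; rewrite act_marks (act_read _ cr) !act_idle.
  exact: rewind_width.
have := @carry_phase B B 0 c1 (Tape c0 L) (bits_tape s1 (size s1)) t4 (Tape c 1) (addn0 B).
rewrite vx; case: ifP => _ [c'].
  by move=> c'A W'; exists c' => //; apply: within_le (within_trans W W'); rewrite /K; clear; lia.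
case=> _ v' W'; exists c', (bits_tape s1 (size s1)), c; split=> //.
by apply: within_le (within_trans W W'); rewrite /K; clear; lia.
Qed.

Lemma main_loop c0 L B t4 S r x c1 h1 t2 c5 :
  c0 L = None -> (forall y, size (nat_to_bits (f1 y)) <= S) -> x + r.+1 = 2 ^ B ->
  c5 0 = None -> h1 <= B -> query (Tape c1 h1) = x -> bitval c1 0 B = x ->
  exists2 c', within (r.+1 * (4 * S + 2 * B + 10)) (loop_cfg c0 L c1 h1 t2 B t4 c5) c' &
    c'.1 = if all (fun y => f1 y == f2 y) (iota x r.+1) then Accept else Reject.
Proof.
move=> c0L sS; elim: r x c1 h1 t2 c5 => [|r IHr] x c1 h1 t2 c5 xr c50 hB Ex vx;
  have := @iteration c0 L c1 h1 t2 B t4 c5 S x c0L c50 (sS x) hB Ex vx; rewrite /=.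
  rewrite -xr addn1 eqxx mul1n.
  by case: eqP => _ /= [c' c'q W]; exists c'.
case: eqP => _ /=; last first.
  by case=> c' c'R W; exists c' => //; apply: within_le W; rewrite mulSn leq_addr.
rewrite ifN; last by apply/eqP; lia.
case=> [c' [t2' [c5' [c50' v' W]]]].
have [|c'' W'' E] := IHr x.+1 c' B t2' c5' _ c50' (leqnn B) v' v'; first by lia.
by exists c'' => //; rewrite mulSn; apply: within_trans W W''.
Qed.

End Run.

(** * Complete runs and the time bound *)

Lemma init_cfg p e :
  init machine p e =
  cfg Start (input_tape p e) blank_tape blank_tape blank_tape blank_tape blank_tape.
Proof. by congr pair; apply: ord6P; case=> [|[|[|[|[|[|]]]]]]. Qed.

(* The sweep reads L bits in about sqrt L round trips, hence the width B below is
   L/2 + O(sqrt L). *)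
Lemma machine_run p e f1 f2 (L := size (nat_to_bits p)) :
  (forall y, f1 y < p) ->
  exists w T, let B := L./2 + w * 8 in
    [/\ w * w <= L < w.+1 * w.+1, T <= 9 * L + 2 + 2 ^ B * (4 * L + 2 * B + 10) &
        outputs_within machine p e f1 f2 T
          (all (fun y => f1 y == f2 y) (iota 0 (2 ^ B)))].
Proof.
move=> f1p; pose c0 := tcont (input_tape p e).
have sbits : size (map Some (nat_to_bits p)) = L by rewrite size_map.
have c0s i : i < L -> c0 i != None.
  move=> iL; rewrite /c0 /= nth_cat sbits iL.
  by have [b ->] := nth_Some iL.
have c0L : c0 L = None by rewrite /c0 /= nth_cat sbits ltnn subnn.
have c5E : tcont blank_tape 0 = None by [].
have [w [h [dir [ok W]]]] :=
  @scan_phase f1 f2 c0 L blank_tape blank_tape (Tape (tcont blank_tape) 1) c0s c0L.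
set B := L./2 + w * 8 in W.
have W0 : within f1 f2 1 (init machine p e)
   (scan_cfg c0 0 0 1 true blank_tape blank_tape (Tape (tcont blank_tape) 1)).
  rewrite init_cfg; apply: within_step; first by apply: step_active.
  cbn [transition nth]; rewrite !act_idle.
  have m0 : blank_tape = marks 0 0.
    by congr Tape; apply: functional_extensionality => -[].
  rewrite [act blank_tape _](_ : _ = Tape (tcont blank_tape) 1); last exact: act_keep.
  rewrite /scan_cfg (_ : Tape (tcont blank_tape) 1 = marks 0 1); last by rewrite m0.
  exact: within_refl.
have [r Er] : exists r, 2 ^ B = r.+1 by exists (2 ^ B).-1; rewrite prednK ?expn_gt0.
have val0 n i : bitval (fun=> None) i n = 0.
  by elim: n i => [//|n IHn] i; rewrite bitvalS IHn.
have [|c' W' Ec'] := @main_loop f1 f2 c0 L B (marks w h) L r 0 (fun=> None) 0 blank_tape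
  (fun=> None) c0L _ (esym Er) erefl (leq0n _) (val0 0 0) (val0 B 0).
  by move=> y; apply: size_nat_to_bits_le.
have [T T_le ET] := within_trans (within_trans W0 W) W'.
exists w, T; split.
- by move: ok; rewrite /sweep_ok; case: dir => /andP[h1 /eqP h2]; apply/andP; split; nia.
- by rewrite -/B Er; move: T_le; lia.
rewrite -/B Er /outputs_within /run ET Ec'.
case: (all _ _); first exact: eqxx.
by apply/andP; split; [exact: eqxx | apply/eqP].
Qed.

(** Take [l = 2 * w] in [shifted_powers_differ]: [L <= 4 ^ w], and the [8 * w] extra marks cover
    [3 * w + 4] and the rounding of [L./2]. *)
Lemma width_suffices p e s t w (L := size (nat_to_bits p)) (B := L./2 + w * 8) :
  valid_input p e s t -> L < w.+1 * w.+1 ->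
  all (fun y => oracle p e s y == oracle p e t y) (iota 0 (2 ^ B)) = (s == t).
Proof.
move=> [p_prime e0 ep e_le /andP[sp tp]] Lw.
case: eqVneq => [->|st]; first by apply/allP => y _; rewrite eqxx.
apply/negbTE/allPn.
have L0 : 0 < L.
  rewrite lt0n; apply/eqP => L0; have := ltn_exp_size_bits p; rewrite -/L L0.
  by have := prime_gt1 p_prime; lia.
have w0 : 0 < w by lia.
have Lw2 : L <= 2 ^ (2 * w).
  apply: leq_trans (ltnW Lw) _; rewrite mulnC expnM; apply: (@leq_trans (2 ^ w * 2 ^ w)).
    by apply: leq_mul; apply: ltn_expl.
  by rewrite -expnM mulnC expnM expnAC.
have [||x xB neq] := shifted_powers_differ p_prime e0 _ sp tp st
  (ltnW (ltn_exp_size_bits p)) Lw2 (B := B) _.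
- by have := prime_gt1 p_prime; lia.
- by rewrite -/L /B; lia.
by exists x => //; rewrite mem_iota.
Qed.

(** As [w.+1 <= 2 ^ w], the polynomial factors are absorbed into [2 ^ (2 * w + 6)]. *)
Lemma time_exponent p w T (L := size (nat_to_bits p)) (B := L./2 + w * 8) :
  w * w <= L < w.+1 * w.+1 ->
  T <= 9 * L + 2 + 2 ^ B * (4 * L + 2 * B + 10) -> T <= 2 ^ (L./2 + 10 * w + 6).
Proof.
move=> /andP[_ Lw] T_le.
have hw : w.+1 <= 2 ^ w by apply: ltn_expl.
rewrite (_ : L./2 + 10 * w + 6 = B + (w + w + 6)); last by rewrite /B; lia.
rewrite expnD; apply: (leq_trans T_le).
have B0 : 0 < 2 ^ B by rewrite expn_gt0.
apply: (@leq_trans (2 ^ B * (13 * L + 2 * B + 12))).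
  by move: (2 ^ B) (B) B0; clear; nia.
rewrite leq_mul2l; apply/orP; right; rewrite !expnD.
apply: (@leq_trans (w.+1 * w.+1 * 2 ^ 6)); last by rewrite leq_mul2r /=; apply: leq_mul.
by rewrite /B; move: (L) Lw; clear; nia.
Qed.

Lemma subexponential_time p k w T (L := size (nat_to_bits p)) : 0 < k ->
  2 ^ (415 * (k * k)) <= p -> w * w <= L -> T <= 2 ^ (L./2 + 10 * w + 6) ->
  T ^ (2 * k) <= p ^ (k + 2).
Proof.
move=> k0 kp wL T_le.
have p0 : 0 < p by apply: leq_trans kp; rewrite expn_gt0.
have Lk : 415 * (k * k) < L.
  rewrite -(ltn_exp2l _ _ (isT : 1 < 2)); apply: leq_ltn_trans kp _.
  exact: ltn_exp_size_bits.
have pL : 2 ^ L.-1 <= p.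
  have := leq_exp_size_bits p0; rewrite -/L; case: (L) Lk => // n _.
  by rewrite expnS leq_pmul2l.
apply: (@leq_trans (2 ^ ((L./2 + 10 * w + 6) * (2 * k)))).
  by rewrite [2 ^ (_ * _)]expnM leq_exp2r // muln_gt0.
apply: (@leq_trans (2 ^ (L.-1 * (k + 2)))); last by rewrite expnM leq_exp2r // addn2.
rewrite leq_exp2l //.
have h : L./2 * 2 <= L by lia.
(* For [w <= 20 * k] the left side is at most [(400 + 13 + 2) * (k * k)], whence 415; otherwise
   [20 * (w * k) <= w * w <= L] and the remaining terms are below [L]. *)
have key : 20 * (w * k) + 13 * k + 2 <= 2 * L.
  have [wk|kw] := leqP w (20 * k).
    have : w * k <= 20 * k * k by rewrite leq_mul2r wk orbT.
    by move: (L) Lk k0; clear; nia.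
  have : 20 * k * w <= w * w by rewrite leq_mul2r (ltnW kw) orbT.
  by move: (L) Lk k0 wL; clear; nia.
by case: (L) h key Lk => [//|n] /=; clear; nia.
Qed.

Theorem theorem3p11 :
  exists M : OTM,
    (forall p e s t, valid_input p e s t ->
       exists T, outputs_within M p e (oracle p e s) (oracle p e t) T (s == t))
    /\
    (* running time p^(1/2 + o(1)): for every k >= 1, for p large enough,
       T <= p^(1/2 + 1/k), i.e. T^(2k) <= p^(k+2) *)
    (forall k, 0 < k -> exists P, forall p e s t, P <= p -> valid_input p e s t ->
       exists T, T ^ (2 * k) <= p ^ (k + 2) /\
         outputs_within M p e (oracle p e s) (oracle p e t) T (s == t)).
Proof.
have run p e s t (L := size (nat_to_bits p)) : valid_input p e s t -> exists w T,
    [/\ w * w <= L, T <= 2 ^ (L./2 + 10 * w + 6) &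
        outputs_within machine p e (oracle p e s) (oracle p e t) T (s == t)].
  move=> v; have oracle_lt y : oracle p e s y < p.
    by rewrite ltn_mod prime_gt0 //; case: v.
  have [w [T [wL T_le out]]] := machine_run e (oracle p e t) oracle_lt.
  have [wL1 wL2] := andP wL.
  exists w, T; split=> //; first exact: time_exponent wL T_le.
  by rewrite -(width_suffices v wL2).
exists machine; split=> [p e s t v|k k0].
  by have [w [T [_ _ out]]] := run p e s t v; exists T.
exists (2 ^ (415 * (k * k))) => p e s t kp v.
have [w [T [wL T_le out]]] := run p e s t v.
by exists T; split=> //; apply: subexponential_time wL T_le.
Qed.
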